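(* There exist a bounded Jordan domain $\mathbb{Y}\subset\mathbb{C}$ and a homeomorphism $h\colon\overline{\mathbb{D}}\to\overline{\mathbb{Y}}$ (onto), where $\mathbb{D}$ is the open unit disk, such that $h\in\mathscr{W}^{1,1}(\mathbb{D},\mathbb{C})$ but its boundary restriction $\varphi=h|_{\partial\mathbb{D}}$ satisfies \[ \int_{\partial\mathbb{D}}\int_{\partial\mathbb{D}}\frac{d_{\mathbb{Y}}(\varphi(x),\varphi(y))}{|x-y|}\,dx\,dy=\infty . \]
   Context: The internal distance $d_{\mathbb{Y}}$ on $\overline{\mathbb{Y}}$ is $d_{\mathbb{Y}}(x,y)=\inf_\gamma|\gamma|$, the infimum of lengths of rectifiable curves $\gamma\subset\overline{\mathbb{Y}}$ connecting $x$ to $y$. Integrals over $\partial\mathbb{D}$ are with respect to arc length measure. *)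

(* Defs.v *)
(* The plane C is modelled as R * R (pairs (Re, Im)). *)
From HB Require Import structures.
From mathcomp Require Import all_boot all_order all_algebra.
From mathcomp Require Import all_classical all_reals all_analysis.
Set Implicit Arguments. Unset Strict Implicit. Unset Printing Implicit Defensive.
Import Order.TTheory GRing.Theory Num.Theory.
Import numFieldNormedType.Exports.
Local Open Scope classical_set_scope.
Local Open Scope ring_scope.

Section Defs.
Variable R : realType.
Local Notation P := (R * R)%type.

Definition eucl_dist (x y : P) : R :=
  Num.sqrt ((x.1 - y.1) ^+ 2 + (x.2 - y.2) ^+ 2).

Definition disk : set P := [set z | z.1 ^+ 2 + z.2 ^+ 2 < 1].
Definition cdisk : set P := [set z | z.1 ^+ 2 + z.2 ^+ 2 <= 1].
Definition circle : set P := [set z | z.1 ^+ 2 + z.2 ^+ 2 = 1].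

Definition expi (t : R) : P := (cos t, sin t).

Definition bdry (A : set P) : set P := closure A `\` interior A.

(* a Jordan curve: the image of the unit circle under a continuous injective
   map (hence a homeomorphic image of the circle, the circle being compact) *)
Definition jordan_curve (G : set P) : Prop :=
  exists g : P -> P, {within circle, continuous g} /\ set_inj circle g /\
    g @` circle = G.

Definition bounded_jordan_domain (Y : set P) : Prop :=
  open Y /\ connected Y /\ Y !=set0 /\ bounded_set Y /\ jordan_curve (bdry Y).

Definition homeo_onto (A B : set P) (h : P -> P) : Prop :=
  {within A, continuous h} /\ set_bij A B h /\
  exists g : P -> P, {within B, continuous g} /\ set_fun B A g /\
    (forall x, A x -> g (h x) = x) /\ (forall y, B y -> h (g y) = y).

Definition polylen (gamma : R -> P) (s : seq R) : R :=
  \sum_(i < (size s).-1) eucl_dist (gamma (nth 0 s i.+1)) (gamma (nth 0 s i)).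

Definition curve_length (gamma : R -> P) : \bar R :=
  ereal_sup [set (polylen gamma s)%:E | s in
     [set s : seq R | sorted <=%R s /\ all (fun t => (0 <= t <= 1)%R) s]].

Definition internal_dist (Ybar : set P) (x y : P) : \bar R :=
  ereal_inf [set curve_length gamma | gamma in
    [set gamma : R -> P | {within `[0, 1], continuous gamma} /\
       gamma @` `[0, 1] `<=` Ybar /\ gamma 0 = x /\ gamma 1 = y /\
       (curve_length gamma < +oo)%E]].

Definition leb2 := (@lebesgue_measure R \x @lebesgue_measure R)%E.

Definition edir (b : bool) : P := if b then (0, 1) else (1, 0).

Fixpoint iterD (l : seq bool) (f : P -> R) : P -> R :=
  match l with
  | [::] => f
  | b :: l' => fun x => 'D_(edir b) (iterD l' f) x
  end.

Definition smooth (f : P -> R) : Prop :=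
  forall l : seq bool, continuous (iterD l f) /\
    forall b x, derivable (iterD l f) x (edir b).

Definition test_fun (U : set P) (f : P -> R) : Prop :=
  smooth f /\ exists K, compact K /\ K `<=` U /\ (forall x, ~ K x -> f x = 0).

Definition W11 (U : set P) (u : P -> R) : Prop :=
  leb2.-integrable U (fun x => (u x)%:E) /\
  forall b : bool, exists g : P -> R, leb2.-integrable U (fun x => (g x)%:E) /\
    forall phi, test_fun U phi ->
      (\int[leb2]_(x in U) (u x * 'D_(edir b) phi x)%:E =
       - \int[leb2]_(x in U) (g x * phi x)%:E)%E.

Definition W11C (U : set P) (h : P -> P) : Prop :=
  W11 U (fun x => (h x).1) /\ W11 U (fun x => (h x).2).

End Defs.

(* Main.v *)
Require Import Defs.
From HB Require Import structures.
From mathcomp Require Import all_boot all_order all_algebra.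
From mathcomp Require Import all_classical all_reals all_analysis.
From mathcomp Require Import measurable_realfun lra ring.
Set Implicit Arguments.
Unset Strict Implicit.
Unset Printing Implicit Defensive.
Import Order.TTheory GRing.Theory Num.Theory.
Import numFieldNormedType.Exports.
Local Open Scope classical_set_scope.
Local Open Scope ring_scope.

(* The map is a vertical shear h(x, y) = (x, y m(x, y)) with
     m(z) = 1 + sum_k a_k |z|^(2 M_k) (2 + T_{N_k}(x)),
   where a_k = 32^-k, N_k = 2^(n_k), M_k = 4^(n_k) and T_N is the Chebyshev
   polynomial.  As m >= 1 is continuous and nondecreasing in |y|, h extends to a
   homeomorphism of the plane, so h(D) is a Jordan domain.  The partial
   derivatives of the k-th layer are O(M_k |z|^(2 M_k)), hence bounded in L^1
   uniformly in k, and a_k is summable: thus h is in W^{1,1}, however fast the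
   N_k grow.  On the circle |z|^(2 M_k) = 1 and T_N(cos t) = cos (N t), so
   h(e^{it}) has ordinate F(t) = sin t (1 + sum_k a_k (2 + cos (N_k t))).  The
   internal distance is at least |F(s) - F(t)|, and for every s with
   sin s >= 1/2 the k-th mode alone contributes at least c a_k log N_k - O(N_{k-1})
   to the integral of |F(s) - F(t)| / |s - t| over t in [s + 1/N_k, s + 1], which is
   unbounded when N_k grows fast enough. *)

(** * Series dominated by a geometric sequence *)

(** Every integrable function on the circle is the trace of a W^{1,1} function (Gagliardo), so
    W^{1,1} regularity puts no price on fast boundary oscillation; the double integral, in contrast,
    grows like log N when a mode of frequency N is added. The only obstacle is to stay injective,
    and this dictates the shape of a layer: 2 + T_N is positive and depends on x alone, |z|^(2 M)
    grows with |y|, so every layer is nondecreasing in |y| at any frequency. The exponent M = N^2 is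
    the size of T_N' on [-1, 1] (Markov): both terms of the x-derivative are then O(M |z|^(2 M)),
    which is concentrated near the circle at thickness 1/M and has integral O(1). The ratio 1/32
    makes all the modes after the k-th add up to at most half of what the k-th contributes on
    average. Measurability of the internal distance is never established: the final comparison uses
    only that the integral of a nonnegative function is a supremum over simple functions below
    it. *)

Section Series.
Variable R : realType.
Implicit Types (u : nat -> R) (C x : R).

Definition amp (k : nat) : R := 32%:R^-1 ^+ k.

Lemma amp_gt0 k : 0 < amp k.
Proof. by rewrite exprn_gt0// invr_gt0. Qed.

Lemma ampS k : amp k.+1 = amp k / 32.
Proof. by rewrite /amp exprSr. Qed.

Lemma amp_cvg0 C : (fun n => C * amp n) @ \oo --> (0 : R).
Proof.
rewrite -(mulr0 C); apply: cvgM; first exact: cvg_cst.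
have := @cvg_geometric R 1 (32%:R^-1); rewrite ger0_norm ?invr_ge0//.
have -> : geometric 1 32%:R^-1 = amp by apply/funext => n /=; rewrite mul1r.
by apply; rewrite invf_lt1 ?ltr0n// ltr1n.
Qed.

Lemma amp_tail u C n m : (forall k, `|u k| <= C * amp k) -> (n <= m)%N ->
  `|series u m - series u n| <= 2 * C * amp n.
Proof.
move=> uC nm; have C0 : 0 <= C.
  by rewrite -(pmulr_lge0 _ (amp_gt0 0)) (le_trans _ (uC 0%N)).
(* The subtracted term lets the induction close: a new term is at most C a_m, while 2 C (a_m -
   a_{m+1}) = (31/16) C a_m. *)
suff : `|series u m - series u n| <= 2 * C * (amp n - amp m).
  move=> /le_trans; apply; apply: ler_wpM2l; first by rewrite mulr_ge0.
  by rewrite gerBl ltW// amp_gt0.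
elim: m nm => [|m IH]; first by rewrite leqn0 => /eqP ->; rewrite !subrr normr0 mulr0.
rewrite leq_eqVlt => /predU1P[->|]; first by rewrite !subrr normr0 mulr0.
rewrite ltnS => /IH{}IH; rewrite seriesSr -addrA addrCA addrC.
apply: le_trans (ler_normD _ _) _.
have := uC m; rewrite ampS; have := amp_gt0 m; have := mulr_ge0 C0 (ltW (amp_gt0 m)).
move: IH; nra.
Qed.

Lemma amp_cvg u C : (forall k, `|u k| <= C * amp k) -> cvgn (series u).
Proof.
move=> uC; apply: normed_cvg; apply: (@series_le_cvg _ _ (geometric C 32%:R^-1)) => //=.
- by move=> n; apply: le_trans (uC n).
- apply: is_cvg_geometric_series.
  by rewrite ger0_norm ?invr_ge0// invf_lt1 ?ltr0n// ltr1n.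
Qed.

Lemma amp_lim_tail u C n : (forall k, `|u k| <= C * amp k) ->
  `|limn (series u) - series u n| <= 2 * C * amp n.
Proof.
move=> uC; have cu := amp_cvg uC.
have cu' : cvgn (fun m => series u m - series u n).
  by apply: is_cvgB => //; exact: is_cvg_cst.
have -> : limn (series u) - series u n = limn (fun m => series u m - series u n).
  by apply/esym/cvg_lim => //; apply: cvgB => //; exact: cvg_cst.
rewrite -lim_norm//; apply: limr_le; first exact: is_cvg_norm.
near=> m; apply: amp_tail => //; near: m; exact: nbhs_infty_ge.
Unshelve. all: by end_near. Qed.

Lemma amp_continuous (T : topologicalType) (f : nat -> T -> R) C :
  (forall k, continuous (f k)) -> (forall k t, `|f k t| <= C * amp k) ->
  continuous (fun t => limn (series (f ^~ t))).
Proof.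
move=> cf fC t; apply/cvgrPdist_lt => e e0.
have cS n : continuous (fun t => series (f ^~ t) n).
  elim: n => [|n IH] x.
    by rewrite /series/=; under eq_fun do rewrite big_geq//; exact: cvg_cst.
  under eq_fun do rewrite seriesSr.
  by apply: cvgD; [exact: IH|exact: cf].
have /cvgrPdist_lt/(_ (e / 3)) := amp_cvg0 (2 * C).
rewrite divr_gt0// => /(_ isT)[n _ /(_ n (leqnn _))].
rewrite /= sub0r normrN => nC.
have tl y : `|limn (series (f ^~ y)) - series (f ^~ y) n| < e / 3.
  by apply: le_lt_trans nC; rewrite (le_trans (amp_lim_tail n (fC^~ y)))// ler_norm.
have /cvgrPdist_lt/(_ (e / 3)) := cS n t.
rewrite divr_gt0// => /(_ isT); apply: filterS => y /=.
have := tl y; have := tl t; rewrite !ltr_norml; lra.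
Qed.

End Series.

(** * Vertical shears of the plane *)

Lemma continuous_pair (T U V : topologicalType) (f : T -> U) (g : T -> V) :
  continuous f -> continuous g -> continuous (fun t => (f t, g t)).
Proof. by move=> cf cg t; exact: (cvg_pair (cf t) (cg t)). Qed.

Lemma fst_continuous (U V : topologicalType) : continuous (@fst U V).
Proof. by move=> z; exact: cvg_fst. Qed.

Lemma snd_continuous (U V : topologicalType) : continuous (@snd U V).
Proof. by move=> z; exact: cvg_snd. Qed.

Lemma continuousT_comp (T U V : topologicalType) (f : T -> U) (g : U -> V) :
  continuous f -> continuous g -> continuous (fun t => g (f t)).
Proof. by move=> cf cg t; apply: continuous_comp; [exact: cf|exact: cg]. Qed.

Lemma continuous_cst (T U : topologicalType) (u : U) : continuous (fun _ : T => u).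
Proof. by move=> t; exact: cvg_cst. Qed.

Lemma continuous_id (T : topologicalType) : continuous (fun t : T => t).
Proof. by move=> t; exact: cvg_id. Qed.

Section RealValued.
Variables (R : realType) (T : topologicalType).
Implicit Types f g : T -> R.

Lemma continuous_add f g : continuous f -> continuous g -> continuous (fun t => f t + g t).
Proof. by move=> cf cg t; apply: cvgD; [exact: cf|exact: cg]. Qed.

Lemma continuous_sub f g : continuous f -> continuous g -> continuous (fun t => f t - g t).
Proof. by move=> cf cg t; apply: cvgB; [exact: cf|exact: cg]. Qed.

Lemma continuous_mul f g : continuous f -> continuous g -> continuous (fun t => f t * g t).
Proof. by move=> cf cg t; apply: cvgM; [exact: cf|exact: cg]. Qed.

Lemma continuous_expn f n : continuous f -> continuous (fun t => f t ^+ n).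
Proof.
move=> cf; elim: n => [|n IH]; first exact: continuous_cst.
by under eq_fun do rewrite exprS; exact: continuous_mul.
Qed.

Lemma near_gt0 f t : continuous f -> 0 < f t -> \forall s \near t, 0 < f s.
Proof. by move=> cf ft; exact: (cf t [set x | 0 < x] (lt_nbhsr ft)). Qed.

End RealValued.

Section Shear.
Variables (R : realType) (m : R * R -> R).
Hypothesis cm : continuous m.
Hypothesis m_ge1 : forall z, 1 <= m z.
Hypothesis m_le : forall x y y' : R, `|y| <= `|y'| -> m (x, y) <= m (x, y').

Definition shear (z : R * R) : R * R := (z.1, z.2 * m z).

Lemma shear_continuous : continuous shear.
Proof.
apply: continuous_pair; first exact: fst_continuous.
by apply: continuous_mul => //; exact: snd_continuous.
Qed.

(** On each side of 0 the factors |y| and m grow together, and values on opposite sides are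
    separated by 0. *)
Lemma shear_lt x (y y' : R) : y < y' -> y * m (x, y) < y' * m (x, y').
Proof.
have m0 z : 0 < m z by rewrite (lt_le_trans ltr01).
move=> yy; have [y0|y0] := leP 0 y.
  apply: (@le_lt_trans _ _ (y * m (x, y'))); last by rewrite ltr_pM2r.
  by rewrite ler_wpM2l// m_le// !ger0_norm// ?ltW// (le_lt_trans y0).
have [y'0|y'0] := leP 0 y'.
  by rewrite (@lt_le_trans _ _ 0)// ?mulr_ge0// ?(ltW (m0 _))// nmulr_rlt0.
apply: (@lt_le_trans _ _ (y' * m (x, y))); first by rewrite ltr_pM2r.
by rewrite ler_wnM2l// ?(ltW y'0)// m_le// !ltr0_norm// lerN2 ltW.
Qed.

Lemma shear_inj : injective shear.
Proof.
move=> [x y] [x' y'] [<-{x'}] yy; congr pair.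
by case: (ltgtP y y') => // /(shear_lt x); rewrite yy ltxx.
Qed.

Lemma shear_ivt x v (a b : R) : a <= b -> a * m (x, a) <= v <= b * m (x, b) ->
  exists2 y, a <= y <= b & shear (x, y) = (x, v).
Proof.
move=> ab /andP[av vb].
have cH : continuous (fun y : R => y * m (x, y)).
  apply: continuous_mul; first exact: continuous_id.
  apply: (@continuousT_comp _ _ _ (fun y : R => (x, y)) m) => //.
  by apply: continuous_pair; [exact: continuous_cst|exact: continuous_id].
have [] := @IVT R (fun y => y * m (x, y)) a b v ab.
- exact: continuous_subspaceT.
- by rewrite ge_min le_max av vb orbT.
by move=> y; rewrite in_itv/= => yab yv; exists y => //; rewrite /shear/= yv.
Qed.

(** As m >= 1, the images of the heights -|v| and |v| already enclose v. *)
Lemma shear_surj z : exists w, shear w = z.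
Proof.
case: z => x v; have [||y _ yE] := @shear_ivt x v (- `|v|) `|v|; last by exists (x, y).
  by rewrite -subr_ge0 opprK addr_ge0.
have := m_ge1 (x, `|v|); have := m_ge1 (x, - `|v|).
move: (m _) (m _) => m1 m2 m11 m21; have v0 := normr_ge0 v.
have /andP[v1 v2] : - `|v| <= v <= `|v| by rewrite -ler_norml.
by apply/andP; split; nra.
Qed.

(** Replaces invariance of domain: the images of the heights y - e/2 and y + e/2 enclose the
    ordinate of the target strictly, hence also that of every nearby point, and the intermediate
    value theorem on the vertical line gives a preimage inside the ball. *)
Lemma shear_open U : open U -> open (shear @` U).
Proof.
move=> oU; rewrite openE => _ [[x y] Uxy <-].
have /nbhs_ballP[e /= e0 eU] : nbhs (x, y) U by exact: open_nbhs_nbhs.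
have e20 : 0 < e / 2 by rewrite divr_gt0.
have cf b : continuous (fun z : R * R => b * m (z.1, b) : R).
  apply: continuous_mul; first exact: continuous_cst.
  apply: (@continuousT_comp _ _ _ (fun z : R * R => (z.1, b)) m) => //.
  by apply: continuous_pair; [exact: fst_continuous|exact: continuous_cst].
have cs : continuous (@snd R R) by exact: snd_continuous.
rewrite /interior /=.
have xe : \forall z \near shear (x, y), ball x e (z.1).
  by apply: cvg_fst; exact: nbhsx_ballx.
have lo : \forall z \near shear (x, y), 0 < z.2 - (y - e / 2) * m (z.1, y - e / 2).
  apply: near_gt0 => /=; first by apply: continuous_sub => //; exact: cf.
  by rewrite subr_gt0; apply: shear_lt; lra.
have hi : \forall z \near shear (x, y), 0 < (y + e / 2) * m (z.1, y + e / 2) - z.2.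
  apply: near_gt0 => /=; first by apply: continuous_sub => //; exact: cf.
  by rewrite subr_gt0; apply: shear_lt; lra.
near=> z; have [||y' /andP[y1 y2] yE] := @shear_ivt z.1 z.2 (y - e / 2) (y + e / 2).
- lra.
- rewrite -[X in X && _]subr_ge0 -[X in _ && X]subr_ge0 !ltW//; [near: z; exact: hi|near: z; exact: lo].
exists (z.1, y'); last by rewrite yE -surjective_pairing.
apply: eU; split => /=; first by near: z.
by rewrite /ball/= ltr_norml; apply/andP; split; lra.
Unshelve. all: by end_near. Qed.

Definition unshear (z : R * R) : R * R := projT1 (cid (shear_surj z)).

Lemma unshearK : cancel unshear shear.
Proof. by move=> z; rewrite /unshear; case: cid. Qed.

Lemma shearK : cancel shear unshear.
Proof. by move=> z; apply: shear_inj; rewrite unshearK. Qed.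

Lemma unshear_continuous : continuous unshear.
Proof.
apply/continuousP => U oU; suff -> : unshear @^-1` U = shear @` U by exact: shear_open.
apply/seteqP; split => [z Uz|_ [z Uz <-]]; first by exists (unshear z); rewrite ?unshearK.
by rewrite /preimage/= shearK.
Qed.

Lemma closure_shear A : closure (shear @` A) = shear @` closure A.
Proof.
apply/seteqP; split => [z clz|_ [z clz <-]]; last first.
  move=> B nB; have /clz[w [Aw Bw]] := shear_continuous nB.
  by exists (shear w); split => //; exists w.
exists (unshear z); last exact: unshearK.
move=> B nB; have := clz ((unshear @^-1` B)).
have nz : nbhs z (unshear @^-1` B) by exact: unshear_continuous.
by move=> /(_ nz)[_ [[w Aw <-] /=]]; rewrite shearK => Bw; exists w.
Qed.

End Shear.

(** * The image of the disk as a Jordan domain *)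

Section Disk.
Variable R : realType.

Lemma sqnorm_continuous : continuous (fun z : R * R => z.1 ^+ 2 + z.2 ^+ 2 : R).
Proof.
by apply: continuous_add; apply: continuous_expn; [exact: fst_continuous|exact: snd_continuous].
Qed.

Lemma scale_continuous (z : R * R) : continuous (fun t : R => (t * z.1, t * z.2)).
Proof.
by apply: continuous_pair; apply: continuous_mul;
  (exact: continuous_id || exact: continuous_cst).
Qed.

Lemma disk_open : open (@disk R).
Proof.
rewrite (_ : @disk R = (fun z => z.1 ^+ 2 + z.2 ^+ 2) @^-1` [set t | t < 1])//.
by apply: open_comp => [z _|]; [exact: sqnorm_continuous|exact: open_lt].
Qed.

Lemma closure_disk : closure (@disk R) = @cdisk R.
Proof.
apply/seteqP; split.
  have /closure_id -> : closed (@cdisk R).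
    rewrite (_ : @cdisk R = (fun z => z.1 ^+ 2 + z.2 ^+ 2) @^-1` [set t | t <= 1])//.
    by apply: closed_comp => [z _|]; [exact: sqnorm_continuous|exact: closed_le].
  by apply: closureS => z; exact: ltW.
move=> z; rewrite /cdisk/= => z1 B nB.
have : \forall t \near (1 : R), B (t * z.1, t * z.2).
  by apply: scale_continuous; rewrite !mul1r -surjective_pairing.
(* Shrinking the point slightly towards 0 brings it into the open disk; the bound 1/2 keeps t
   positive. *)
move=> /nbhs_ballP[e /= e0 eB]; pose t := 1 - Num.min (e / 2) (1 / 2).
have [t0 t1 te] : [/\ 0 < t, t < 1 & ball (1 : R) e t].
  rewrite /t /ball/=; case: (ltP (e / 2) (1 / 2)) => ?; split; rewrite ?ltr_norml; lra.
exists (t * z.1, t * z.2); split; last exact: eB.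
rewrite /disk/=; nra.
Qed.

Lemma disk_connected : connected (@disk R).
Proof.
have -> : @disk R = \bigcup_(z in @disk R) [set (t * z.1, t * z.2) | t in `[0, 1]].
  apply/seteqP; split => [z Dz|w [z Dz [t]]].
    exists z => //; exists 1; first by rewrite /= in_itv/= ler01 lexx.
    by rewrite !mul1r -surjective_pairing.
  rewrite /= in_itv/= => /andP[t0 t1] <-; move: Dz; rewrite /disk/=.
    apply: le_lt_trans; rewrite !exprMn -mulrDr ler_piMl ?addr_ge0 ?sqr_ge0//.
    by rewrite expr_le1.
apply: bigcup_connected; first last.
  move=> z _; apply: connected_continuous_connected; first exact: segment_connected.
  by apply: continuous_subspaceT; exact: scale_continuous.
exists (0, 0) => z _; exists 0; first by rewrite /= in_itv/= ler01 lexx.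
by rewrite !mul0r.
Qed.

Variable m : R * R -> R.
Hypothesis cm : continuous m.
Hypothesis m_ge1 : forall z, 1 <= m z.
Hypothesis m_le : forall x y y' : R, `|y| <= `|y'| -> m (x, y) <= m (x, y').
Variable c : R.
Hypothesis m_lec : forall z, m z <= c.

(** The shear is a homeomorphism of the whole plane, so it carries closure and interior of the disk
    to those of the image, and its restriction to the circle parametrises the boundary. *)
Lemma shear_jordan_domain : bounded_jordan_domain (shear m @` @disk R).
Proof.
split; first by apply: shear_open => //; exact: disk_open.
split.
  apply: connected_continuous_connected; first exact: disk_connected.
  by apply: continuous_subspaceT; exact: shear_continuous.
split; first by exists (shear m (0, 0)), (0, 0) => //; rewrite /disk/= expr0n addr0.
have c1 : 1 <= c by rewrite (le_trans (m_ge1 (0, 0))).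
split.
  exists c; split; first exact: num_real.
  move=> M M1 w [[x y]]; rewrite /disk/= => z1 <-.
  rewrite prod_normE ge_max/=; apply/andP; split.
    by apply: ltW; rewrite ltr_norml; nra.
  have := m_ge1 (x, y); have := m_lec (x, y) => mc m1.
  rewrite normrM (ger0_norm (le_trans ler01 m1)).
  have := normr_ge0 y; have : `|y| < 1 by rewrite ltr_norml; nra.
  nra.
exists (shear m); split; first by apply: continuous_subspaceT; exact: shear_continuous.
split; first by move=> z w _ _; exact: shear_inj.
have oD := shear_open cm m_ge1 m_le disk_open.
rewrite /bdry (closure_shear cm m_ge1 m_le) closure_disk (interior_id _).1//.
apply/seteqP; split.
  move=> w [z]; rewrite /circle/= => z1 <-; split; first by exists z => //; rewrite /cdisk/= z1.
  by move=> [w' Dw /(shear_inj m_ge1 m_le) wz]; move: Dw; rewrite wz /disk/= z1 ltxx.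
move=> _ [[z z1 <-] nD]; exists z => //; rewrite /circle/=; apply/eqP.
rewrite eq_le; apply/andP; split; first exact: z1.
by rewrite leNgt; apply/negP => Dz; apply: nD; exists z.
Qed.

Lemma shear_homeo : homeo_onto (@cdisk R) (closure (shear m @` @disk R)) (shear m).
Proof.
rewrite (closure_shear cm m_ge1 m_le) closure_disk.
split; first by apply: continuous_subspaceT; exact: shear_continuous.
split.
  split; first by move=> z Dz; exists z.
    by move=> z w _ _; exact: shear_inj.
  by [].
exists (unshear cm m_ge1); split.
  by apply: continuous_subspaceT; exact: unshear_continuous.
split; first by move=> _ [z Dz <-] /=; rewrite shearK.
by split => z _; [rewrite shearK|rewrite unshearK].
Qed.

End Disk.

(** * The modulus of the shear *)

Section Modulus.
Variables (R : realType) (frq : nat -> nat).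
Implicit Types (x y : R) (z : R * R).

(** The Chebyshev polynomial T_N for N = 2^n, obtained from the doubling rule T_{2N} = 2 T_N^2 -
    1. *)
Fixpoint cheb n x : R := if n is n'.+1 then 2 * cheb n' x ^+ 2 - 1 else x.

Fixpoint dcheb n x : R := if n is n'.+1 then 4 * cheb n' x * dcheb n' x else 1.

Lemma cheb_norm n x : `|x| <= 1 -> `|cheb n x| <= 1.
Proof. by move=> x1; elim: n => //= n; rewrite !ler_norml; nra. Qed.

(** Each doubling costs a factor 4 |T| <= 4. The resulting N^2 is attained at x = 1 and fixes the
    exponent [4 ^ frq k] of a layer. *)
Lemma dcheb_norm n x : `|x| <= 1 -> `|dcheb n x| <= 4 ^+ n.
Proof.
move=> x1; elim: n => [|n IH] /=; first by rewrite normr1 expr0.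
rewrite !normrM exprS (ger0_norm (ler0n R 4)) -mulrA ler_pM2l ?ltr0n//.
rewrite -[leRHS]mul1r; apply: ler_pM => //; exact: cheb_norm.
Qed.

Lemma cheb_cos n x : cheb n (cos x) = cos (2 ^+ n * x).
Proof.
elim: n => [|n IH] /=; first by rewrite expr0 mul1r.
by rewrite IH [in RHS]exprS -mulrA [in RHS]mulr_natl cos_mulr2n mulr_natl.
Qed.

Lemma cheb_continuous n : continuous (cheb n).
Proof.
elim: n => [|n IH] /=; first exact: continuous_id.
apply: continuous_sub; last exact: continuous_cst.
by apply: continuous_mul; [exact: continuous_cst|exact: continuous_expn].
Qed.

Definition clamp x : R := Num.max (-1) (Num.min x 1).

Lemma clamp_continuous : continuous clamp.
Proof.
move=> x; apply: (@continuous_max R R (fun=> -1) (fun x => Num.min x 1)).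
  exact: continuous_cst.
by apply: continuous_min; [exact: continuous_id|exact: continuous_cst].
Qed.

Lemma clamp_norm x : `|clamp x| <= 1.
Proof.
rewrite /clamp ler_norml le_max lexx/= ge_max ge_min lexx orbT andbT.
by rewrite (le_trans (lerN10 _))// ler01.
Qed.

Lemma clamp_id x : `|x| <= 1 -> clamp x = x.
Proof. by rewrite ler_norml /clamp => /andP[x1 x2]; rewrite min_l// max_r. Qed.

(* The two truncations make the layers bounded on the whole plane without
   changing them on the closed disk. *)
Definition layer k z : R :=
  Num.min (z.1 ^+ 2 + z.2 ^+ 2) 1 ^+ (4 ^ frq k) * (2 + cheb (frq k) (clamp z.1)).

Definition modulus z : R := 1 + limn (series (fun k => amp R k * layer k z)).

Lemma layer_continuous k : continuous (layer k).
Proof.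
apply: continuous_mul.
  apply: continuous_expn => z.
  apply: (@continuous_min R (R * R)%type (fun z => z.1 ^+ 2 + z.2 ^+ 2) (fun=> 1)).
    exact: sqnorm_continuous.
  exact: continuous_cst.
apply: continuous_add; first exact: continuous_cst.
apply: (@continuousT_comp _ _ _ (fun z => clamp z.1)); last exact: cheb_continuous.
apply: continuousT_comp; [exact: fst_continuous|exact: clamp_continuous].
Qed.

Lemma sqmin_itv z : 0 <= Num.min (z.1 ^+ 2 + z.2 ^+ 2) 1 <= 1.
Proof. by rewrite le_min ler01 andbT addr_ge0 ?sqr_ge0//= ge_min lexx orbT. Qed.

Lemma layer_itv k z : 0 <= layer k z <= 3.
Proof.
have /andP[s0 s1] := sqmin_itv z; rewrite /layer.
have e0 : 0 <= Num.min (z.1 ^+ 2 + z.2 ^+ 2) 1 ^+ (4 ^ frq k) by rewrite exprn_ge0.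
have e1 : Num.min (z.1 ^+ 2 + z.2 ^+ 2) 1 ^+ (4 ^ frq k) <= 1 by rewrite exprn_ile1.
have := cheb_norm (frq k) (clamp_norm z.1); rewrite ler_norml => /andP[c1 c2].
by apply/andP; split; nra.
Qed.

Lemma layer_le k x y y' : `|y| <= `|y'| -> layer k (x, y) <= layer k (x, y').
Proof.
move=> yy; rewrite /layer /=; apply: ler_wpM2r.
  have := cheb_norm (frq k) (clamp_norm x); rewrite ler_norml; lra.
have /andP[s0 s1] := sqmin_itv (x, y); have /andP[t0 t1] := sqmin_itv (x, y').
apply: lerXn2r => //; rewrite le_min !ge_min lexx orbT andbT lerD2l.
by rewrite -(real_normK (num_real y)) -(real_normK (num_real y')) lerXn2r ?nnegrE ?normr_ge0.
Qed.

Lemma amp_layer k z : `|amp R k * layer k z| <= 3 * amp R k.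
Proof.
have a0 := amp_gt0 R k; have /andP[l0 l3] := layer_itv k z.
by rewrite ger0_norm; [nra|rewrite mulr_ge0// ltW].
Qed.

Lemma modulus_cvg z : cvgn (series (fun k => amp R k * layer k z)).
Proof. by apply: amp_cvg => k; exact: amp_layer. Qed.

Lemma modulus_continuous : continuous modulus.
Proof.
apply: continuous_add; first exact: continuous_cst.
apply: (@amp_continuous _ _ _ 3) => k; last exact: amp_layer.
by apply: continuous_mul; [exact: continuous_cst|exact: layer_continuous].
Qed.

Lemma modulus_ge1 z : 1 <= modulus z.
Proof.
rewrite lerDl; apply: limr_ge; first exact: modulus_cvg.
apply: nearW => n; apply: sumr_ge0 => k _.
by apply: mulr_ge0; [exact: ltW (amp_gt0 R k)|case/andP: (layer_itv k z)].
Qed.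

Lemma modulus_le7 z : modulus z <= 7.
Proof.
(* The bound 7 is 1 + 2 * 3: layers are at most 3 and the amplitudes are summed with the factor
   2. *)
have := amp_lim_tail 0 (fun k => amp_layer k z).
rewrite /series/= big_geq// subr0 /amp expr0 mulr1 ler_norml => /andP[_].
by rewrite /modulus; lra.
Qed.

Lemma modulus_le x y y' : `|y| <= `|y'| -> modulus (x, y) <= modulus (x, y').
Proof.
move=> yy; rewrite lerD2l; apply: ler_lim; [exact: modulus_cvg|exact: modulus_cvg|].
apply: nearW => n; apply: ler_sum => k _.
by apply: ler_wpM2l; [exact: ltW (amp_gt0 R k)|exact: layer_le].
Qed.

End Modulus.

(** * Oscillation on the circle *)

Section Boundary.
Variable R : realType.
Implicit Types s t : R.

Lemma lipschitz1 (f df : R -> R) : (forall x : R, is_derive x 1 f (df x)) ->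
  (forall x, `|df x| <= 1) -> forall s t, `|f s - f t| <= `|s - t|.
Proof.
move=> fd df1; have le s t : s <= t -> `|f s - f t| <= `|s - t|.
  move=> st; rewrite distrC [leRHS]distrC.
  have [|c _ ->] := MVT_segment st (fun x _ => fd x).
    by apply: continuous_subspaceT => x; apply: differentiable_continuous; apply/derivable1_diffP.
  by rewrite normrM ler_piMl.
by move=> s t; have [/le//|/ltW/le] := leP s t; rewrite distrC [leRHS]distrC.
Qed.

Lemma cos_lipschitz s t : `|cos s - cos t| <= `|s - t|.
Proof.
apply: (@lipschitz1 cos (fun x => - sin x)) => x; rewrite normrN ler_norml.
by rewrite sin_geN1 sin_le1.
Qed.

Lemma sin_lipschitz s t : `|sin s - sin t| <= `|s - t|.
Proof. by apply: (@lipschitz1 sin cos) => x; rewrite ler_norml cos_geN1 cos_le1. Qed.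

Lemma eucl_dist_expi s t : eucl_dist (expi s) (expi t) <= 2 * `|s - t|.
Proof.
apply: (@le_trans _ _ (Num.sqrt ((2 * `|s - t|) ^+ 2))); last first.
  by rewrite sqrtr_sqr ger0_norm// mulr_ge0.
apply: ler_wsqrtr => /=.
have sq x y : `|x| <= `|y| -> x ^+ 2 <= y ^+ 2 :> R.
  by move=> xy; rewrite -(real_normK (num_real x)) -(real_normK (num_real y)) lerXn2r// nnegrE.
have := sq _ _ (cos_lipschitz s t); have := sq _ _ (sin_lipschitz s t).
rewrite exprMn real_normK ?num_real//; have := sqr_ge0 (s - t); lra.
Qed.

Lemma le_eucl_dist (x y : R * R) : `|x.2 - y.2| <= eucl_dist x y.
Proof. by rewrite /eucl_dist -sqrtr_sqr ler_wsqrtr// lerDr sqr_ge0. Qed.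

Lemma le_internal_dist (A : set (R * R)) x y :
  ((eucl_dist x y)%:E <= internal_dist A x y)%E.
Proof.
apply: le_ereal_inf_tmp => _ [gamma [_ [_ [<- [<- _]]]] <-].
(* The coarsest subdivision of the curve already has the length of the chord. *)
apply: ereal_sup_ubound; exists [:: 0; 1].
  by rewrite /= !lexx ler01.
by rewrite /polylen/= big_ord1/= /eucl_dist -[in RHS]sqrrN opprB -[X in _ + X]sqrrN opprB.
Qed.

Variable frq : nat -> nat.
Local Notation modulus := (@modulus R frq).
Local Notation layer := (@layer R frq).

Definition freq k : R := 2 ^+ frq k.

Lemma layer_expi k t : layer k (expi t) = 2 + cos (freq k * t).
Proof.
rewrite /layer /expi/= cos2Dsin2 minxx expr1n mul1r clamp_id ?cheb_cos//.
by rewrite ler_norml cos_geN1 cos_le1.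
Qed.

Definition edge t : R := sin t * modulus (expi t).

Lemma expi_continuous : continuous (@expi R).
Proof. by apply: continuous_pair; [exact: continuous_cos|exact: continuous_sin]. Qed.

Lemma edge_continuous : continuous edge.
Proof.
apply: continuous_mul; first exact: continuous_sin.
by apply: continuousT_comp; [exact: expi_continuous|exact: modulus_continuous].
Qed.

(* The k-th mode dominates: the lower modes are Lipschitz and the higher ones
   have small total amplitude. *)
Lemma modulus_osc k s t :
  amp R k * `|cos (freq k * s) - cos (freq k * t)| - amp R k / 8 -
    (\sum_(0 <= j < k) freq j) * `|s - t|
  <= `|modulus (expi s) - modulus (expi t)|.
Proof.
pose d j := amp R j * (cos (freq j * s) - cos (freq j * t)).
have d2 j : `|d j| <= 2 * amp R j.
  rewrite normrM ger0_norm ?(ltW (amp_gt0 R j))// mulrC.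
  apply: ler_wpM2r; first exact: ltW (amp_gt0 R j).
  by rewrite (le_trans (ler_normB _ _))// (lerD (y := 1) (t := 1))// ler_norml cos_geN1 cos_le1.
have -> : modulus (expi s) - modulus (expi t) = limn (series d).
  rewrite /modulus opprD addrACA subrr add0r; apply/esym/cvg_lim => //.
  have -> : series d = (fun n => series (fun k => amp R k * layer k (expi s)) n -
      series (fun k => amp R k * layer k (expi t)) n).
    apply/funext => n; rewrite /series/= -sumrB; apply: eq_bigr => j _.
    by rewrite !layer_expi /d; ring.
  by apply: cvgB; apply: modulus_cvg.
(* The tail past the k-th mode is at most 4 a_{k+1} = a_k / 8. *)
have := amp_lim_tail k.+1 d2; rewrite ampS seriesSr.
have : `|series d k| <= (\sum_(0 <= j < k) freq j) * `|s - t|.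
  rewrite /series/= mulr_suml; apply: le_trans (ler_norm_sum _ _ _) _.
  apply: ler_sum => j _; rewrite normrM.
  apply: (@le_trans _ _ (1 * `|freq j * s - freq j * t|)).
    apply: ler_pM => //; last exact: cos_lipschitz.
    rewrite ger0_norm ?(ltW (amp_gt0 R j))// /amp exprn_ile1 ?invr_ge0//.
    by rewrite invf_le1 ?ltr0n// ler1n.
  by rewrite mul1r -mulrBr normrM ger0_norm// exprn_ge0.
have -> : amp R k * `|cos (freq k * s) - cos (freq k * t)| = `|d k|.
  by rewrite normrM (ger0_norm (ltW (amp_gt0 R k))).
move: (limn _) (series d k) (d k) => L S D; rewrite !ler_norml => /andP[S1 S2] /andP[L1 L2].
have a0 := amp_gt0 R k.
have : D <= `|D| by exact: ler_norm.
have : - D <= `|D| by rewrite -normrN ler_norm.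
have : L <= `|L| by exact: ler_norm.
have : - L <= `|L| by rewrite -normrN ler_norm.
by have [D0|D0] := leP 0 D; [rewrite (ger0_norm D0)|rewrite (ltr0_norm D0)]; lra.
Qed.

(** The factor sin s >= 1/2 halves the estimate for [modulus], and varying it costs at most 7 |s -
    t|. Since a difference of cosines is at most 2 in absolute value, it dominates half its square;
    the square is a trigonometric polynomial, so that a primitive can be written down below. *)
Lemma edge_osc k s t : 1 / 2 <= sin s ->
  amp R k * (cos (freq k * s) - cos (freq k * t)) ^+ 2 / 4 - amp R k / 16 -
    ((\sum_(0 <= j < k) freq j) / 2 + 7) * `|s - t|
  <= `|edge s - edge t|.
Proof.
move=> s2; have := modulus_osc k s t.
have : `|cos (freq k * s) - cos (freq k * t)| <= 2.
  by rewrite (le_trans (ler_normB _ _))// (lerD (y := 1) (t := 1))// ler_norml cos_geN1 cos_le1.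
rewrite -(real_normK (num_real (cos (freq k * s) - cos (freq k * t)))).
have := normr_ge0 (cos (freq k * s) - cos (freq k * t)).
move: (`|cos _ - _|) => c c0 c2.
have := sin_lipschitz s t.
have -> : edge s - edge t = sin s * (modulus (expi s) - modulus (expi t)) +
   modulus (expi t) * (sin s - sin t) by rewrite /edge; ring.
have := modulus_ge1 frq (expi t); have := modulus_le7 frq (expi t).
move: (modulus _) (modulus _) (\sum_(_ <= j < _) _) => ms mt S mt7 mt1 sst.
have := normr_ge0 (s - t); move: (`|s - t|) sst => D sst D0 cc.
have a0 := amp_gt0 R k.
have h1 : `|mt * (sin s - sin t)| <= 7 * D.
  by rewrite normrM ger0_norm ?(le_trans ler01 mt1)//; apply: ler_pM => //; exact: le_trans mt1.
have h2 : 1 / 2 * `|ms - mt| <= `|sin s * (ms - mt)|.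
  by rewrite normrM ler_wpM2r// (le_trans s2)// ler_norm.
have h3 : `|sin s * (ms - mt)| - `|mt * (sin s - sin t)| <=
   `|sin s * (ms - mt) + mt * (sin s - sin t)| by exact: lerB_normD.
apply: le_trans h3; apply: le_trans (lerB h2 h1).
have : 0 <= amp R k * c * (2 - c) by rewrite !mulr_ge0 ?subr_ge0// ltW.
lra.
Qed.

End Boundary.

(** * Logarithmic lower bound *)

Section Derivatives.
Variable R : realType.
Implicit Types (f g : R -> R) (t : R).

Lemma der_cst c t : is_derive t 1 (fun=> c) (0 : R).
Proof. exact: is_derive_cst. Qed.

Lemma der_id t : is_derive t 1 (fun t : R => t) (1 : R).
Proof. exact: is_derive_id. Qed.

Lemma derD f g t df dg : is_derive t 1 f df -> is_derive t 1 g dg ->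
  is_derive t 1 (fun t => f t + g t) (df + dg).
Proof. by move=> ? ?; exact: is_deriveD. Qed.

Lemma derM f g t df dg : is_derive t 1 f df -> is_derive t 1 g dg ->
  is_derive t 1 (fun t => f t * g t) (df * g t + f t * dg).
Proof.
move=> fd gd; apply: (is_derive_eq (is_deriveM fd gd)).
by rewrite /GRing.scale/= addrC (mulrC df).
Qed.

Lemma derV f t df : f t != 0 -> is_derive t 1 f df ->
  is_derive t 1 (fun t => (f t)^-1) (- df / f t ^+ 2).
Proof.
move=> f0 fd; apply: (is_derive_eq (is_deriveV f0 fd)).
by rewrite /GRing.scale/= mulNr mulrC -mulNr.
Qed.

Lemma der_comp f g t df dg : is_derive (g t) 1 f df -> is_derive t 1 g dg ->
  is_derive t 1 (fun t => f (g t)) (df * dg).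
Proof. exact: is_derive1_comp. Qed.

Lemma derXn f n t df : is_derive t 1 f df ->
  is_derive t 1 (fun t => f t ^+ n) (n%:R * f t ^+ n.-1 * df).
Proof.
move=> fd; elim: n => [|n IH]; first by rewrite mul0r mul0r; exact: der_cst.
under eq_fun do rewrite exprS.
apply: (is_derive_eq (derM fd IH)); case: n {IH} => [|n] /=; first by rewrite !mul0r mulr0 !expr0; ring.
by rewrite [in RHS]mulrSr !exprS; ring.
Qed.

Lemma der_continuous f t df : is_derive t 1 f df -> {for t, continuous f}.
Proof.
move=> fd; apply: differentiable_continuous; apply/derivable1_diffP; exact: ex_derive.
Qed.

Lemma ftc F f (a b : R) : a < b ->
  (forall t, a <= t <= b -> is_derive t 1 F (f t)) ->
  (forall t, a <= t <= b -> {for t, continuous f}) ->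
  (\int[lebesgue_measure]_(t in `[a, b]) (f t)%:E = (F b - F a)%:E)%E.
Proof.
move=> ab Ff cf.
have cF t : a <= t <= b -> {for t, continuous F}.
  by move=> tab; apply: der_continuous (Ff t tab).
rewrite EFinB; apply: continuous_FTC2 => //.
- by apply: continuous_in_subspaceT => t; rewrite inE/= in_itv/= => /cf.
- split.
  + by move=> t; rewrite in_itv/= => /andP[? ?]; apply: ex_derive; apply: Ff; rewrite !ltW.
  + by apply: cvg_at_right_filter; apply: cF; rewrite lexx ltW.
  + by apply: cvg_at_left_filter; apply: cF; rewrite lexx ltW.
- move=> t; rewrite in_itv/= => /andP[? ?]; rewrite derive1E.
  by apply: derive_val; apply: Ff; rewrite !ltW.
Qed.

End Derivatives.

(** * An explicit minorant with logarithmic growth *)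

Section LogLowerBound.
Variable R : realType.
Variables (a N c L s : R).
Hypotheses (a0 : 0 <= a) (N1 : 1 < N) (c1 : `|c| <= 1) (L0 : 0 <= L).

(* [ripple] is N times a primitive of the oscillating part of
   (c - cos (N t))^2 = c^2 + 1/2 + ..., shifted so as to be nonnegative. *)
Definition ripple (t : R) : R :=
  - (2 * c) * sin (N * t) + sin (N * t) * cos (N * t) / 2 + 5 / 2.

(** Primitive of a minorant of D / (2 (t - s)), where D is the lower bound of [edge_osc]. The mean
    c^2 + 1/2 of (c - cos (N t))^2 yields the logarithm; the oscillating part over t - s is
    integrated by parts, and the resulting term in -[ripple] / (N (t - s)^2) is kept in the
    derivative because it is nonpositive. *)
Definition logminor (t : R) : R :=
  (a / 8) * ((c ^+ 2 + 1 / 2) * ln (t - s) + ripple t * (t - s)^-1 / N)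
  - (a / 32) * ln (t - s) - L / 2 * (t - s).

Definition dlogminor (t : R) : R :=
  (a / 8) * ((c - cos (N * t)) ^+ 2 * (t - s)^-1 - ripple t * (t - s)^-1 ^+ 2 / N)
  - (a / 32) * (t - s)^-1 - L / 2.

Lemma ripple_itv t : 0 <= ripple t <= 5.
Proof.
have := sin_geN1 (N * t); have := sin_le1 (N * t).
have := cos_geN1 (N * t); have := cos_le1 (N * t).
move: c1; rewrite /ripple ler_norml; move: (sin _) (cos _) => S C /andP[cl cr] C1 C2 S1 S2.
have /andP[p1 p2] : -1 <= c * S <= 1 by apply/andP; split; nra.
have /andP[q1 q2] : -1 <= S * C <= 1 by apply/andP; split; nra.
by apply/andP; split; lra.
Qed.

Lemma der_logminor t : s < t -> is_derive t 1 logminor (dlogminor t).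
Proof.
move=> st; have d0 : t - s != 0 by rewrite gt_eqF// subr_gt0.
have N0 : N != 0 by rewrite gt_eqF// (lt_trans ltr01).
have dd : is_derive t 1 (fun t => t - s) (1 : R).
  by apply: (is_derive_eq (derD (der_id t) (der_cst (- s) t))); rewrite addr0.
have dl : is_derive t 1 (fun t => ln (t - s)) (t - s)^-1.
  have st0 : 0 < t - s by rewrite subr_gt0.
  have := @der_comp R (@ln R) (fun t => t - s) t _ _ (is_derive1_ln st0) dd.
  by rewrite mulr1.
have dr : is_derive t 1 ripple ((- (2 * c) * cos (N * t) + (cos (N * t) ^+ 2 - sin (N * t) ^+ 2) / 2) * N).
  by rewrite /ripple; apply: is_derive_eq; rewrite /GRing.scale/=; field.
have dv : is_derive t 1 (fun t => (t - s)^-1) (- 1 / (t - s) ^+ 2).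
  exact: (@derV R (fun t => t - s) t _ d0 dd).
rewrite /logminor; apply: is_derive_eq; rewrite /GRing.scale/=.
have := cos2Dsin2 (N * t); rewrite /dlogminor.
move: (sin _) (cos _) (ripple _) => S C P SC.
have -> : S ^+ 2 = 1 - C ^+ 2 by rewrite -SC; ring.
by field; rewrite N0 d0.
Qed.

Lemma dlogminor_continuous t : s < t -> {for t, continuous dlogminor}.
Proof.
move=> st; have d0 : t - s != 0 by rewrite gt_eqF// subr_gt0.
have dd : is_derive t 1 (fun t => t - s) (1 : R).
  by apply: (is_derive_eq (derD (der_id t) (der_cst (- s) t))); rewrite addr0.
have dv : is_derive t 1 (fun t => (t - s)^-1) (- 1 / (t - s) ^+ 2).
  exact: (@derV R (fun t => t - s) t _ d0 dd).
have dr : derivable ripple t 1 by exact: ex_derive.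
apply: differentiable_continuous; apply/derivable1_diffP.
rewrite /dlogminor /ripple; exact: ex_derive.
Qed.

(** The coefficient of ln N is a (c^2 + 1/2) / 8 - a / 32 >= a / 32. At distance 1/N from s the
    boundary term is a / 8 times [ripple], hence at most 5 a / 8, which -a absorbs. *)
Lemma logminor_increment :
  a * ln N / 32 - a - L / 2 <= logminor (s + 1) - logminor (s + N^-1).
Proof.
have N0 : 0 < N by rewrite (lt_trans ltr01).
rewrite /logminor !(addrC s) !addrK ln1 invr1 lnV ?posrE// invrK.
have := ripple_itv (1 + s); have := ripple_itv (N^-1 + s).
move: (ripple _) (ripple _) => p q /andP[p0 p5] /andP[q0 q5].
have l0 : 0 <= ln N by rewrite ln_ge0// ltW.
have -> : q * N / N = q by rewrite mulfK// gt_eqF.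
have h1 : 0 <= a * (p * 1 / N) by rewrite mulr_ge0// mulr1 divr_ge0// ltW.
have h2 : 0 <= a * (c ^+ 2) * ln N by apply: mulr_ge0 => //; apply: mulr_ge0 => //; exact: sqr_ge0.
have h3 : a * q <= a * 5 by rewrite ler_wpM2l.
have h4 : 0 <= L * N^-1 by rewrite mulr_ge0// invr_ge0 ltW.
have h5 : 0 <= a * ln N by rewrite mulr_ge0.
move: h1 h2 h3 h4 h5; move: (N^-1) (ln N) => y l h1 h2 h3 h4 h5.
rewrite -subr_ge0; set X := (X in 0 <= X).
have -> : X = a * (p * 1 * y) / 8 + a * c ^+ 2 * l / 8 + (a * 5 - a * q) / 8 + a * 3 / 8 +
   L * y / 2 by rewrite /X; field.
by rewrite !addr_ge0// divr_ge0// ?subr_ge0// mulr_ge0.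
Qed.

(** The lower bound of D divided by 2 (t - s) exceeds [dlogminor] by exactly the [ripple] term,
    which is nonnegative. *)
Lemma dlogminor_le t D : s < t ->
  a * (c - cos (N * t)) ^+ 2 / 4 - a / 16 - L * (t - s) <= D ->
  dlogminor t <= D / (2 * (t - s)).
Proof.
move=> st; have d0 : 0 < t - s by rewrite subr_gt0.
have N0 : 0 < N by rewrite (lt_trans ltr01).
have /andP[r0 _] := ripple_itv t.
have -> : D / (2 * (t - s)) = D * ((t - s)^-1 / 2) by rewrite invfM; ring.
move=> h; have v0 : 0 < (t - s)^-1 by rewrite invr_gt0.
apply: le_trans (ler_wpM2r _ h); last by rewrite divr_ge0// ltW.
have hr : 0 <= a * (ripple t * (t - s)^-1 ^+ 2 / N).
  apply: mulr_ge0 => //; apply: divr_ge0; last exact: ltW.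
  by apply: mulr_ge0 => //; apply: exprn_ge0; exact: ltW.
rewrite /dlogminor -subr_ge0; set X := (X in 0 <= X).
suff -> : X = a * (ripple t * (t - s)^-1 ^+ 2 / N) / 8 by rewrite divr_ge0.
by rewrite /X; field; rewrite !gt_eqF.
Qed.

Lemma integral_dlogminor :
  (\int[lebesgue_measure]_(t in `[(s + N^-1)%R, (s + 1)%R]) (dlogminor t)%:E =
   (logminor (s + 1) - logminor (s + N^-1))%R%:E)%E.
Proof.
have N0 : 0 < N by rewrite (lt_trans ltr01).
have lt t : s + N^-1 <= t <= s + 1 -> s < t.
  by move=> /andP[h _]; apply: lt_le_trans h; rewrite ltrDl invr_gt0.
apply: ftc.
- by rewrite ltrD2l invf_lt1.
- by move=> t /lt; exact: der_logminor.
- by move=> t /lt; exact: dlogminor_continuous.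
Qed.

End LogLowerBound.

(** * Divergence of the double integral *)

(** No measurability is assumed: a simple function below f is also below g. This is what allows
    integrands built from the internal distance. *)
Lemma le_lower_integral d (T : measurableType d) (R : realType)
    (mu : {measure set T -> \bar R}) (D : set T) (f g : T -> \bar R) :
  (forall x, D x -> 0 <= f x <= g x)%E ->
  (\int[mu]_(x in D) f x <= \int[mu]_(x in D) g x)%E.
Proof.
move=> fg; have f0 x : D x -> (0 <= f x)%E by move=> /fg/andP[].
have le x : D x -> (f x <= g x)%E by move=> /fg/andP[].
rewrite !ge0_integralE//; last by move=> x Dx; exact: le_trans (f0 _ Dx) (le _ Dx).
apply: ereal_sup_le => _ /= [h hf <-]; exists h => // x.
by apply: le_trans (hf x) _; rewrite !patchE; case: ifPn => // /[!inE]; exact: le.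
Qed.

Section Frequencies.
Variable R : realType.

(** Chosen so that a_k ln N_k / 32 >= N_{k-1}: the factor 32^k cancels a_k, and 64 pays for the 32
    and for ln 2 >= 1/2. *)
Fixpoint frq (k : nat) : nat :=
  if k is j.+1 then (64 * 32 ^ k * 2 ^ frq j)%N else 1%N.

Lemma frq_ge k : (k < frq k)%N.
Proof.
elim: k => [|k IH] //=; apply: (@leq_ltn_trans (frq k)) => //.
apply: (@leq_trans (2 ^ frq k)); first exact: ltn_expl.
by apply: leq_pmull; rewrite muln_gt0 expn_gt0.
Qed.

(** The frequencies at least double at each step, so the last one dominates the sum. *)
Lemma freq_sum k : \sum_(0 <= j < k.+1) freq R frq j <= 2 * freq R frq k.
Proof.
elim: k => [|k IH]; first by rewrite big_nat1 /freq ler_peMl// ?exprn_ge0// ler1n.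
rewrite big_nat_recr//=; apply: (@le_trans _ _ (freq R frq k.+1 + freq R frq k.+1)); last first.
  by rewrite -mulr2n mulr_natl.
rewrite lerD2r; apply: le_trans IH _; rewrite /freq -exprS ler_eXn2l ?ltr1n//.
rewrite /= -mulnA; apply: (@leq_trans (2 ^ frq k)); first exact: ltn_expl.
by rewrite mulnA; apply: leq_pmull; rewrite muln_gt0 expn_gt0.
Qed.

Lemma ln2_ge : 1 / 2 <= ln (2 : R).
Proof.
have : ln (1 + (- (1 / 2))) <= - (1 / 2) :> R by apply: le_ln1Dx; lra.
have -> : 1 + (- (1 / 2)) = 2^-1 :> R by lra.
by rewrite lnV ?posrE// lerN2.
Qed.

Lemma freq_growth (A : R) : exists k, 1 < freq R frq k /\
  A <= amp R k * ln (freq R frq k) / 32 - amp R k -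
       ((\sum_(0 <= j < k) freq R frq j) / 2 + 7) / 2.
Proof.
(* The main term is at least [freq R frq k]; the lower modes take at most half of it and the
   constants 1 + 7/2. As [freq R frq k] >= k + 1 > 2 (|A| + 5), more than |A| remains. *)
pose k := Num.truncn (2 * (`|A| + 5)); exists k.+1.
have kA : 2 * (`|A| + 5) < k.+1%:R by exact: truncnS_gt.
split; first by rewrite /freq exprn_egt1 ?ltr1n// -lt0n (leq_ltn_trans _ (frq_ge _)).
have kf : k.+1%:R <= freq R frq k.
  rewrite /freq -natrX ler_nat; apply: leq_trans (frq_ge k) _; exact/ltnW/ltn_expl.
have := freq_sum k; move: (\sum_(_ <= _ < _) _) => S Sk.
have a1 : amp R k.+1 <= 1 by rewrite /amp exprn_ile1 ?invr_ge0// invf_le1 ?ltr0n// ler1n.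
suff : freq R frq k <= amp R k.+1 * ln (freq R frq k.+1) / 32.
  by have := ler_norm A; lra.
rewrite {2}/freq lnXn//.
have -> : freq R frq k = amp R k.+1 * ((frq k.+1)%:R * (1 / 2)) / 32.
  rewrite /amp [frq k.+1]/= !natrM !natrX exprVn /freq; field.
  by rewrite expf_neq0.
rewrite ler_wpM2r ?invr_ge0// ler_wpM2l ?(ltW (amp_gt0 _ _))//.
by rewrite -[leRHS]mulr_natl ler_wpM2l// ln2_ge.
Qed.

Local Notation edge := (@edge R frq).

(** A measurable minorant of the integrand of the theorem: 2 |s - t| bounds the chord from above. On
    the diagonal it is 0, since the inverse of 0 is 0. *)
Definition edge_quot (z : R * R) : R := `|edge z.1 - edge z.2| * (2 * `|z.1 - z.2|)^-1.

Lemma edge_quot_ge0 z : 0 <= edge_quot z.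
Proof. by rewrite mulr_ge0// invr_ge0 mulr_ge0. Qed.

Lemma measurable_edge_quot : measurable_fun setT edge_quot.
Proof.
(* The real power agrees with the inverse even at 0, and it is measurable on the whole line. *)
have -> : edge_quot = (fun z => `|edge z.1 - edge z.2| * (2 * `|z.1 - z.2|) `^ (-1)).
  by apply/funext => z; rewrite powR_inv1// mulr_ge0.
have me : measurable_fun setT edge by apply: continuous_measurable_fun; exact: edge_continuous.
apply: measurable_funM.
  apply: measurableT_comp => //; apply: measurable_funB.
    exact: (measurableT_comp me).
  exact: (measurableT_comp me).
apply: (measurableT_comp (measurable_powR _)); apply: measurable_funM => //.
by apply: measurableT_comp => //; apply: measurable_funB.
Qed.

Lemma inner_integral_edge_quot (s : R) : 0 <= s -> s + 1 <= 2 * pi -> 1 / 2 <= sin s ->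
  (\int[lebesgue_measure]_(t in `[0%R, (2 * pi)%R]) (edge_quot (s, t))%:E = +oo)%E.
Proof.
move=> s0 s2 ss; apply/eqyP => A _.
have mq D : measurable_fun D (fun t => (edge_quot (s, t))%:E).
  apply/measurable_EFinP/measurable_funTS; apply: (measurableT_comp measurable_edge_quot).
  exact: pair1_measurable.
have [k [N1 Ak]] := freq_growth A.
set N := freq R frq k in N1 Ak; set S := \sum_(_ <= _ < _) _ in Ak.
have N0 : 0 < N by rewrite (lt_trans ltr01).
have a0 := ltW (amp_gt0 R k).
have c1 : `|cos (N * s)| <= 1 by rewrite ler_norml cos_geN1 cos_le1.
have S0 : 0 <= S by apply: sumr_ge0 => j _; rewrite exprn_ge0.
have L0 : 0 <= S / 2 + 7 by rewrite addr_ge0// divr_ge0.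
pose I : set R := `[s + N^-1, s + 1]%classic.
have mI : measurable I by exact: measurable_itv.
have lts t : I t -> s < t.
  by rewrite /I/= in_itv/= => /andP[h _]; apply: lt_le_trans h; rewrite ltrDl invr_gt0.
have sub : (\int[lebesgue_measure]_(t in I) (edge_quot (s, t))%:E <=
            \int[lebesgue_measure]_(t in `[0%R, (2 * pi)%R]) (edge_quot (s, t))%:E)%E.
  apply: ge0_subset_integral => //.
  - exact: mq.
  - by move=> t _; rewrite lee_fin edge_quot_ge0.
  - move=> t It; have := lts _ It; move: It; rewrite /I/= !in_itv/=; lra.
apply: le_trans sub.
(* The minorant [dlogminor] can be negative, so comparing integrals requires integrability of both
   sides; if it fails for [edge_quot], the integral is already infinite. *)
have [->|fin] := eqVneq (\int[lebesgue_measure]_(t in I) (edge_quot (s, t))%:E)%E +oo%E; first exact: leey.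
have iq : lebesgue_measure.-integrable I (fun t => (edge_quot (s, t))%:E).
  apply/integrableP; split; first exact: mq.
  under eq_integral => t _ do rewrite gee0_abs ?lee_fin ?edge_quot_ge0//.
  by rewrite ltey.
apply: (@le_trans _ _ (logminor (amp R k) N (cos (N * s)) (S / 2 + 7) s (s + 1) -
   logminor (amp R k) N (cos (N * s)) (S / 2 + 7) s (s + N^-1))%:E).
  by rewrite lee_fin (le_trans Ak)//; exact: logminor_increment.
rewrite -(integral_dlogminor (amp R k) (cos (N * s)) (S / 2 + 7) s N1).
apply: le_integral => //.
  apply: continuous_compact_integrable; first exact: segment_compact.
  by apply: continuous_in_subspaceT => t; rewrite inE => /lts; exact: dlogminor_continuous.
move=> t; rewrite inE => /lts st; rewrite lee_fin /edge_quot/=.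
rewrite (distrC s t) (gtr0_norm (x := t - s)) ?subr_gt0//.
apply: dlogminor_le => //.
by have := edge_osc frq k t ss; rewrite distrC (gtr0_norm (x := t - s)) ?subr_gt0.
Qed.

Lemma double_integral_edge_quot :
  (\int[@leb2 R]_(z in `[0%R, (2 * pi)%R] `*` `[0%R, (2 * pi)%R]) (edge_quot z)%:E = +oo)%E.
Proof.
set B := _ `*` _.
have mB : measurable B by exact: measurableX.
rewrite integral_mkcond fubini_tonelli1; first last.
- by move=> z; apply: erestrict_ge0 => w _; rewrite lee_fin edge_quot_ge0.
- by apply/(measurable_restrictT _ _).1 => //; apply/measurable_EFinP/measurable_funTS; exact: measurable_edge_quot.
apply/eqP; rewrite -leye_eq.
have pi2 := pi_ge2 R.
(* On this interval of positive length sin >= 1/2, because sin (pi / 2) = 1 and sin is 1-Lipschitz;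
   every inner integral over it is infinite. *)
pose J : set R := `[pi / 2, pi / 2 + 1 / 2]%classic.
have -> : +oo%E = (\int[lebesgue_measure]_(s in J) (cst +oo s))%E :> \bar R.
  rewrite integral_cst//=; last exact: measurable_itv.
  rewrite lebesgue_measure_itv/= lte_fin ltrDl divr_gt0//.
  by rewrite -EFinB gt0_mulye// lte_fin; lra.
rewrite integral_mkcond; apply: le_lower_integral => s _; rewrite patchE.
case: ifPn => [|_]; last first.
  rewrite lexx/=; apply: integral_ge0 => t _.
  by apply: erestrict_ge0 => w _; rewrite lee_fin edge_quot_ge0.
rewrite inE /J/= in_itv/= => /andP[s1 s2]; rewrite leye_eq /fubini_F; apply/andP; split => //.
have s01 : 0 <= s <= 2 * pi by apply/andP; split; lra.
suff -> : (fun t => ((fun z => (edge_quot z)%:E) \_ B) (s, t)) =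
   (fun t => (edge_quot (s, t))%:E) \_ `[0, 2 * pi].
  rewrite -integral_mkcond inner_integral_edge_quot//; [lra|lra|].
  have := sin_lipschitz s (pi / 2); rewrite sin_pihalf !ler_norml ger0_norm; lra.
apply/funext => t; rewrite !patchE; congr (if _ then _ else _).
by apply/idP/idP; rewrite !inE /B/= !in_itv/= => // -[].
Qed.

End Frequencies.

(** * Integration over the disk *)

Section Plane.
Variable R : realType.
Implicit Types (f u g v phi : R * R -> R) (b : bool).

Lemma rat_between (x y : R) : x < y -> exists p : rat, x < ratr p < y.
Proof. by move=> /rat_in_itvoo[p]; rewrite in_itv/= => ?; exists p. Qed.

Lemma open_measurable_prod (U : set (R * R)) : open U -> measurable U.
Proof.
move=> oU; pose box (p q r s : rat) : set (R * R) :=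
  `]ratr p, ratr q[%classic `*` `]ratr r, ratr s[%classic.
(* Rational boxes form a countable base; those not contained in U are replaced by the empty set. *)
have -> : U = \bigcup_p \bigcup_q \bigcup_r \bigcup_s
    (if `[< box p q r s `<=` U >] then box p q r s else set0).
  apply/seteqP; split => [[x y] Uxy|z [p _ [q _ [r _ [s _]]]]]; last first.
    by case: ifPn => // /asboolP BU /BU.
  have /nbhs_ballP[e /= e0 eU] : nbhs (x, y) U by exact: open_nbhs_nbhs.
  have [] : x - e < x /\ y - e < y by split; lra.
  move=> /rat_between[p /andP[p1 p2]] /rat_between[r /andP[r1 r2]].
  have [] : x < x + e /\ y < y + e by split; lra.
  move=> /rat_between[q /andP[q1 q2]] /rat_between[s /andP[s1 s2]].
  exists p => //; exists q => //; exists r => //; exists s => //.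
  rewrite asboolT; first by split; rewrite /= in_itv/= ?p2 ?q1 ?r2 ?s1.
  move=> [x' y'] [] /=; rewrite !in_itv/= => /andP[? ?] /andP[? ?].
  by apply: eU; split; rewrite /ball/= ltr_norml; lra.
do 4 (apply: bigcupT_measurable_rat => ?).
by case: ifPn => // _; apply: measurableX; exact: measurable_itv.
Qed.

Lemma continuous_measurable_prod f : continuous f -> measurable_fun setT f.
Proof.
move=> /continuousP cf; apply: (measurability _ (RGenOInfty.measurableE R)).
move=> _ [_ [a ->] <-]; rewrite setTI; apply: open_measurable_prod; apply: cf.
exact: interval_open.
Qed.

(** A product domain around the disk: test functions vanish off the disk, so integrals may be taken
    here, where Fubini reduces them to segments. *)
Definition square : set (R * R) := `[-1, 1]%classic `*` `[-1, 1]%classic.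

Lemma disk_square : @disk R `<=` square.
Proof. by move=> [x y]; rewrite /disk/= => xy; split; rewrite /= in_itv/=; nra. Qed.

Lemma measurable_square : measurable square.
Proof. by apply: measurableX; exact: measurable_itv. Qed.

Lemma measurable_disk : measurable (@disk R).
Proof. by apply: open_measurable_prod; exact: disk_open. Qed.

Lemma square_finite : (@leb2 R square < +oo)%E.
Proof.
rewrite /leb2 /square product_measure1E; [|exact: measurable_itv|exact: measurable_itv].
change (@lebesgue_measure R `[(-1)%R, 1%R]%classic * @lebesgue_measure R `[(-1)%R, 1%R]%classic < +oo)%E.
by rewrite lebesgue_measure_itv/= lte_fin; case: ifP => _; rewrite -?EFinD -?EFinM ltry.
Qed.

Lemma continuous_bounded_square f : continuous f ->
  exists2 M, 0 <= M & forall z, square z -> `|f z| <= M.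
Proof.
move=> cf.
have : compact (f @` square).
  apply: continuous_compact; first exact: continuous_subspaceT.
  by apply: compact_setX; exact: segment_compact.
move=> /compact_bounded[M [_ /(_ (`|M| + 1))]].
have -> : M < `|M| + 1 by rewrite (le_lt_trans (ler_norm M))// ltrDl.
move=> /(_ isT) fM; exists (`|M| + 1); first by rewrite addr_ge0.
by move=> z Qz; apply: fM; exists z.
Qed.

Lemma continuous_integrable_square f : continuous f ->
  (@leb2 R).-integrable square (fun z => (f z)%:E).
Proof.
move=> cf; apply: measurable_bounded_integrable => //.
- exact: measurable_square.
- exact: square_finite.
- by apply: measurable_funTS; exact: continuous_measurable_prod.
have [M M0 fM] := continuous_bounded_square cf.
exists M; split; first exact: num_real.
by move=> x Mx z Qz; apply: le_trans (fM z Qz) (ltW Mx).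
Qed.

Lemma continuous_integrable_disk f : continuous f ->
  (@leb2 R).-integrable (@disk R) (fun z => (f z)%:E).
Proof.
move=> cf; apply: integrableS (continuous_integrable_square cf).
- exact: measurable_square.
- exact: measurable_disk.
- exact: disk_square.
Qed.

(** Partial derivatives are expressed along coordinate lines, with [b] read as in [edir], so that
    the one-variable rules and the fundamental theorem apply directly. *)
Definition pder b u g : Prop := forall x y : R,
  if b then is_derive y 1 (fun y => u (x, y)) (g (x, y))
  else is_derive x 1 (fun x => u (x, y)) (g (x, y)).

Lemma pder_derive b phi : (forall z, derivable phi z (edir R b)) ->
  pder b phi (fun z => 'D_(edir R b) phi z).
Proof.
have e1 x y : (fun h : R => h^-1 *: ((phi \o shift (x, y)) (h *: ((1, 0) : R * R)) - phi (x, y))) =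
   (fun h => h^-1 *: (((fun x => phi (x, y)) \o shift x) (h *: (1 : R)) - phi (x, y))).
  apply/funext => h; rewrite /shift/=; congr (_ *: (phi _ - _)).
  by congr pair => /=; rewrite scaler0 add0r.
have e2 x y : (fun h : R => h^-1 *: ((phi \o shift (x, y)) (h *: ((0, 1) : R * R)) - phi (x, y))) =
   (fun h => h^-1 *: (((fun y => phi (x, y)) \o shift y) (h *: (1 : R)) - phi (x, y))).
  apply/funext => h; rewrite /shift/=; congr (_ *: (phi _ - _)).
  by congr pair => /=; rewrite scaler0 add0r.
move=> dphi x y; have := dphi (x, y); case: b {dphi} => /=; rewrite /derivable => dphi.
  by apply: DeriveDef; rewrite /derivable /derive -e2.
by apply: DeriveDef; rewrite /derivable /derive -e1.
Qed.

Lemma pderM b u g v w : pder b u g -> pder b v w ->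
  pder b (fun z => u z * v z) (fun z => g z * v z + u z * w z).
Proof.
move=> ug vw x y; have := ug x y; have := vw x y.
by case: b {ug vw} => vw ug; exact: derM ug vw.
Qed.

Lemma pderD b u g v w : pder b u g -> pder b v w ->
  pder b (fun z => u z + v z) (fun z => g z + w z).
Proof.
move=> ug vw x y; have := ug x y; have := vw x y.
by case: b {ug vw} => vw ug; exact: derD ug vw.
Qed.

Lemma integral_square f : continuous f ->
  (\int[@leb2 R]_(z in square) (f z)%:E =
   \int[lebesgue_measure]_(x in `[(-1)%R, 1%R]) \int[lebesgue_measure]_(y in `[(-1)%R, 1%R]) (f (x, y))%:E)%E
  /\ (\int[@leb2 R]_(z in square) (f z)%:E =
   \int[lebesgue_measure]_(y in `[(-1)%R, 1%R]) \int[lebesgue_measure]_(x in `[(-1)%R, 1%R]) (f (x, y))%:E)%E.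
Proof.
move=> cf.
have fi' : (@leb2 R).-integrable setT ((fun z => (f z)%:E) \_ square).
  apply: (iffLR (integrable_mkcond _ _)); first exact: measurable_square.
  exact: continuous_integrable_square.
split; rewrite integral_mkcond.
  rewrite -(integral12_prod_meas1 fi') [RHS]integral_mkcond; apply: eq_integral => x _.
  rewrite patchE /fubini_F; case: ifPn => [|nx].
    rewrite inE => Ix; rewrite [RHS]integral_mkcond; apply: eq_integral => y _; rewrite !patchE.
    by congr (if _ then _ else _); apply/idP/idP; rewrite !inE /square/= => // -[].
  apply: integral0_eq => y _; rewrite patchE; case: ifPn => //; rewrite inE => -[Ix _].
  by move: nx; rewrite notin_setE => /(_ Ix).
rewrite -(integral21_prod_meas1 fi') [RHS]integral_mkcond; apply: eq_integral => y _.
rewrite patchE /fubini_G; case: ifPn => [|ny].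
  rewrite inE => Iy; rewrite [RHS]integral_mkcond; apply: eq_integral => x _; rewrite !patchE.
  by congr (if _ then _ else _); apply/idP/idP; rewrite !inE /square/= => // -[].
apply: integral0_eq => x _; rewrite patchE; case: ifPn => //; rewrite inE => -[_ Iy].
by move: ny; rewrite notin_setE => /(_ Iy).
Qed.

(** Integrate first along the direction of differentiation: the ends of each segment lie on the
    sides of the square, hence outside the open disk, where v vanishes. *)
Lemma integral_pder0 b v w : continuous w -> pder b v w ->
  (forall z, ~ disk z -> v z = 0) ->
  (\int[@leb2 R]_(z in square) (w z)%:E = 0)%E.
Proof.
move=> cw vw v0; have [i1 i2] := integral_square cw.
have cx x : continuous (fun y => w (x, y)).
  by apply: (continuousT_comp _ cw); apply: continuous_pair; [exact: continuous_cst|exact: continuous_id].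
have cy y : continuous (fun x => w (x, y)).
  by apply: (continuousT_comp _ cw); apply: continuous_pair; [exact: continuous_id|exact: continuous_cst].
have o : -1 < 1 :> R by lra.
case: b vw => vw; [rewrite i1|rewrite i2]; apply: integral0_eq => t _.
  rewrite (@ftc R (fun y => v (t, y)) (fun y => w (t, y)) _ _ o (fun y _ => vw t y) (fun y _ => cx t y)).
  by rewrite !v0 ?subrr// /disk/=; apply/negP; rewrite -leNgt; nra.
rewrite (@ftc R (fun x => v (x, t)) (fun x => w (x, t)) _ _ o (fun x _ => vw x t) (fun x _ => cy t x)).
by rewrite !v0 ?subrr// /disk/=; apply/negP; rewrite -leNgt; nra.
Qed.

Lemma test_fun_facts phi b : test_fun (@disk R) phi ->
  [/\ continuous phi, continuous (fun z => 'D_(edir R b) phi z),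
      pder b phi (fun z => 'D_(edir R b) phi z),
      forall z, ~ disk z -> phi z = 0 & forall z, ~ disk z -> 'D_(edir R b) phi z = 0].
Proof.
move=> [sm [K [cK [KD K0]]]].
have out z : ~ disk z -> phi z = 0 by move=> nD; apply: K0 => /KD.
have dphi z : derivable phi z (edir R b) by have [_] := sm [::]; apply.
split => //; first by have [] := sm [::].
- by have [] := sm [:: b].
- exact: pder_derive.
move=> z nD; have nK : (~` K) z by move=> /KD.
have oK : open (~` K) by apply: closed_openC; apply: compact_closed => //; exact: norm_hausdorff.
have nz : nbhs z (~` K) by exact: open_nbhs_nbhs.
rewrite (@near_eq_derive _ _ _ phi (cst 0)) ?derive_cst//.
by near=> w; rewrite K0//; near: w; exact: nz.
Unshelve. all: by end_near. Qed.

Lemma integration_by_parts_disk b u g phi : continuous u -> continuous g -> pder b u g ->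
  test_fun (@disk R) phi ->
  (\int[@leb2 R]_(z in @disk R) (u z * 'D_(edir R b) phi z)%:E =
   - \int[@leb2 R]_(z in @disk R) (g z * phi z)%:E)%E.
Proof.
move=> cu cg ug tphi.
have [cphi cD pD phi0 D0] := test_fun_facts b tphi.
have c1 : continuous (fun z => u z * 'D_(edir R b) phi z) by exact: continuous_mul.
have c2 : continuous (fun z => g z * phi z) by exact: continuous_mul.
have i1 := continuous_integrable_disk c1; have i2 := continuous_integrable_disk c2.
have : (\int[@leb2 R]_(z in square) (g z * phi z + u z * 'D_(edir R b) phi z)%:E = 0)%E.
  apply: (integral_pder0 _ (pderM ug pD)); first exact: continuous_add.
  by move=> z nD; rewrite phi0// mulr0.
have -> : (\int[@leb2 R]_(z in square) (g z * phi z + u z * 'D_(edir R b) phi z)%:E =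
   \int[@leb2 R]_(z in @disk R) (g z * phi z + u z * 'D_(edir R b) phi z)%:E)%E.
  rewrite integral_mkcond [RHS]integral_mkcond; apply: eq_integral => z _; rewrite !patchE.
  case: ifPn => [_|nQ]; case: ifPn => //.
    by rewrite notin_setE => nD; rewrite phi0// D0// !mulr0 addr0.
  by rewrite inE => /disk_square Qz; move: nQ; rewrite notin_setE => /(_ Qz).
under eq_integral do rewrite EFinD.
rewrite integralD//; last exact: measurable_disk.
have /fineK <- : (\int[@leb2 R]_(z in @disk R) (u z * 'D_(edir R b) phi z)%:E)%E \is a fin_num.
  by apply: integrable_fin_num i1; exact: measurable_disk.
have /fineK <- : (\int[@leb2 R]_(z in @disk R) (g z * phi z)%:E)%E \is a fin_num.
  by apply: integrable_fin_num i2; exact: measurable_disk.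
by rewrite -EFinD -EFinN => -[] /eqP; rewrite addrC addr_eq0 => /eqP ->.
Qed.

End Plane.

(** * Weak derivatives as limits *)

Section WeakDerivative.
Variable R : realType.

Lemma dominated_disk (f_ : nat -> R * R -> R) (f : R * R -> R) (D : R * R -> \bar R) :
  (forall n, measurable_fun (@disk R) (f_ n)) ->
  (forall z, @disk R z -> (fun n => f_ n z) @ \oo --> f z) ->
  (@leb2 R).-integrable (@disk R) D ->
  (forall n z, @disk R z -> (`|f_ n z|%:E <= D z)%E) ->
  (@leb2 R).-integrable (@disk R) (fun z => (f z)%:E) /\
  (fun n => \int[@leb2 R]_(z in @disk R) (f_ n z)%:E)%E @ \oo -->
    (\int[@leb2 R]_(z in @disk R) (f z)%:E)%E.
Proof.
move=> mf cf iD fD.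
have [] // := @dominated_convergence _ _ R (@leb2 R) (@disk R) _
  (fun n z => (f_ n z)%:E) (fun z => (f z)%:E) D.
- exact: measurable_disk.
- by move=> n; apply/measurable_EFinP; exact: mf.
- by apply/measurable_EFinP; apply: (measurable_fun_cvg mf).
- apply: aeW => z Dz; apply: cvg_EFin; first by exact: nearW.
  exact: cf.
- by apply: aeW => z n Dz; exact: fD.
Qed.

(** Integration by parts holds for each U n, and both sides pass to the limit by dominated
    convergence; differentiability of u itself is not asked for. *)
Lemma weak_derivative_limit b (U G : nat -> R * R -> R) (u g : R * R -> R)
    (D : R * R -> \bar R) (C : R) :
  (forall n, continuous (U n)) -> (forall n, continuous (G n)) ->
  (forall n, pder b (U n) (G n)) ->
  (forall n z, @disk R z -> `|U n z| <= C) ->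
  (forall n z, @disk R z -> (`|G n z|%:E <= D z)%E) ->
  (forall z, @disk R z -> (fun n => U n z) @ \oo --> u z) ->
  (forall z, @disk R z -> (fun n => G n z) @ \oo --> g z) ->
  (@leb2 R).-integrable (@disk R) D ->
  (@leb2 R).-integrable (@disk R) (fun z => (g z)%:E) /\
  forall phi, test_fun (@disk R) phi ->
    (\int[@leb2 R]_(z in @disk R) (u z * 'D_(edir R b) phi z)%:E =
     - \int[@leb2 R]_(z in @disk R) (g z * phi z)%:E)%E.
Proof.
move=> cU cG UG UC GD Uu Gg iD.
have mf f : continuous f -> measurable_fun (@disk R) (f : R * R -> R).
  by move=> cf; apply: measurable_funTS; exact: continuous_measurable_prod.
split; first by have [] := dominated_disk (fun n => mf _ (cG n)) Gg iD GD.
move=> phi tphi; have [cphi cD _ _ _] := test_fun_facts b tphi.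
have [M1 M10 DM] := continuous_bounded_square cD.
have [M2 M20 PM] := continuous_bounded_square cphi.
have [||||_ lim1] := @dominated_disk (fun n z => U n z * 'D_(edir R b) phi z)
    (fun z => u z * 'D_(edir R b) phi z) (fun=> (C * M1)%:E).
- by move=> n; apply: mf; exact: continuous_mul.
- by move=> z Dz; apply: cvgM; [exact: Uu|exact: cvg_cst].
- by apply: (@continuous_integrable_disk R (fun=> C * M1)); exact: continuous_cst.
- move=> n z Dz; rewrite lee_fin normrM; apply: ler_pM => //; first exact: UC.
  by apply: DM; exact: disk_square.
have [||||_ lim2] := @dominated_disk (fun n z => G n z * phi z)
    (fun z => g z * phi z) (fun z => M2%:E * D z)%E.
- by move=> n; apply: mf; exact: continuous_mul.
- by move=> z Dz; apply: cvgM; [exact: Gg|exact: cvg_cst].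
- by apply: integrableZl => //; exact: measurable_disk.
- move=> n z Dz; rewrite normrM EFinM muleC; apply: lee_pmul.
  + by rewrite lee_fin.
  + by rewrite lee_fin.
  + by rewrite lee_fin; apply: PM; exact: disk_square.
  + exact: GD.
rewrite -(cvg_lim _ lim1)//; apply/cvg_lim => //.
have -> : (fun n => \int[@leb2 R]_(z in @disk R) (U n z * 'D_(edir R b) phi z)%:E)%E =
  (fun n => - \int[@leb2 R]_(z in @disk R) (G n z * phi z)%:E)%E.
  by apply/funext => n; exact: integration_by_parts_disk.
exact: cvgeN.
Qed.

(* The derivative of t |-> t (t^2 + c^2)^M, whose integral over the chord at height [c]
   is the length of the chord. *)
Definition chordw (M : nat) (t c : R) : R :=
  M%:R * (t ^+ 2 + c ^+ 2) ^+ M.-1 * (2 * t) * t + (t ^+ 2 + c ^+ 2) ^+ M.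

Lemma chordw_ge0 M t c : 0 <= chordw M t c.
Proof.
have q0 : 0 <= t ^+ 2 + c ^+ 2 by rewrite addr_ge0 ?sqr_ge0.
apply: addr_ge0; last exact: exprn_ge0.
rewrite -mulrA; apply: mulr_ge0; first by rewrite mulr_ge0// exprn_ge0.
by rewrite -mulrA -expr2; apply: mulr_ge0 => //; exact: sqr_ge0.
Qed.

Lemma chordw_continuous M : continuous (fun z : R * R => chordw M z.1 z.2).
Proof.
have cq := @sqnorm_continuous R; have c1 := @fst_continuous R R.
apply: continuous_add; last exact: continuous_expn.
apply: continuous_mul => //; apply: continuous_mul; last first.
  by apply: continuous_mul => //; exact: continuous_cst.
by apply: continuous_mul; [exact: continuous_cst|exact: continuous_expn].
Qed.

(** The primitive t (t^2 + c^2)^M equals t at the ends of the chord, where t^2 + c^2 = 1. This is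
    the source of all bounds uniform in M. *)
Lemma chordw_integral M c :
  (\int[lebesgue_measure]_t
     (if (t ^+ 2 + c ^+ 2 < 1)%R then (chordw M t c)%:E else 0) <=
   if (-1 <= c <= 1)%R then 2%:E else 0)%E.
Proof.
have [c1|c1] := ltP (c ^+ 2) 1; last first.
  rewrite integral0_eq; first by case: ifP => // _; rewrite lee_fin.
  by move=> t _; rewrite ifN// -leNgt (le_trans c1)// lerDr sqr_ge0.
pose B := Num.sqrt (1 - c ^+ 2).
have B0 : 0 < B by rewrite sqrtr_gt0 subr_gt0.
have B2 : B ^+ 2 = 1 - c ^+ 2 by rewrite sqr_sqrtr// subr_ge0 ltW.
have B1 : B <= 1 by have := sqr_ge0 c; nra.
have -> : -1 <= c <= 1 by apply/andP; split; nra.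
apply: (@le_trans _ _ (\int[lebesgue_measure]_(t in `[(- B)%R, B]) (chordw M t c)%:E)%E).
  rewrite [leRHS]integral_mkcond; apply: le_lower_integral => t _.
  rewrite patchE; case: ifPn => [tc|_].
    rewrite mem_set ?lee_fin ?lexx ?chordw_ge0//= in_itv/=; nra.
  by rewrite lexx/=; case: ifPn => // _; rewrite lee_fin chordw_ge0.
have dF (t : R) : is_derive t 1 (fun t => (t ^+ 2 + c ^+ 2) ^+ M * t) (chordw M t c).
  have dq : is_derive t 1 (fun t => t ^+ 2 + c ^+ 2) (2 * t).
    apply: (is_derive_eq (derD (derXn 2 (der_id t)) (der_cst (c ^+ 2) t))).
    by rewrite /= expr1 mulr1 addr0.
  by apply: (is_derive_eq (derM (derXn M dq) (der_id t))); rewrite mulr1.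
have NB : - B < B by lra.
have cw (t : R) : {for t, continuous (chordw M ^~ c)}.
  apply: (@continuousT_comp _ _ _ (fun t : R => (t, c)) _ _ (@chordw_continuous M)).
  by apply: continuous_pair; [exact: continuous_id|exact: continuous_cst].
rewrite (ftc NB (fun t _ => dF t) (fun t _ => cw t)).
by rewrite sqrrN B2 subrK expr1n !mul1r opprK lee_fin; lra.
Qed.

Lemma chordw_integral_disk M :
  (\int[@leb2 R]_(z in @disk R) (chordw M z.1 z.2)%:E <= 4%:E)%E /\
  (\int[@leb2 R]_(z in @disk R) (chordw M z.2 z.1)%:E <= 4%:E)%E.
Proof.
have four : (\int[@lebesgue_measure R]_c (if (-1 <= (c : R) <= 1)%R then 2%:E else 0) = 4%:E)%E.
  have e : forall c : R, (if (-1 <= c <= 1)%R then 2%:E else 0%E) =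
      ((cst (2%:E : \bar R)) \_ `[(-1)%R, 1%R]%classic) c.
    by move=> c; rewrite patchE mem_setE in_itv.
  under eq_integral do rewrite e.
  rewrite -integral_mkcond integral_cst//= lebesgue_measure_itv/= lte_fin.
  rewrite ifT; last lra.
  by rewrite -EFinD -EFinM; congr EFin; lra.
have cw : continuous (fun z : R * R => chordw M z.2 z.1).
  apply: (@continuousT_comp _ _ _ (fun z : R * R => (z.2, z.1)) _ _ (@chordw_continuous M)).
  by apply: continuous_pair; [exact: snd_continuous|exact: fst_continuous].
have mr f : continuous f -> measurable_fun setT ((fun z => (f z : R)%:E) \_ (@disk R)).
  move=> cf; apply/(measurable_restrictT _ _).1; first exact: measurable_disk.
  by apply/measurable_EFinP/measurable_funTS; exact: continuous_measurable_prod.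
split; rewrite integral_mkcond -four.
  rewrite fubini_tonelli2; first last.
  - by move=> z; apply: erestrict_ge0 => w _; rewrite lee_fin chordw_ge0.
  - by apply: mr; exact: chordw_continuous.
  apply: le_lower_integral => c _; apply/andP; split.
    by apply: integral_ge0 => t _; apply: erestrict_ge0 => w _; rewrite lee_fin chordw_ge0.
  apply: le_trans (chordw_integral M c); rewrite /fubini_G.
  rewrite le_eqVlt; apply/orP; left; apply/eqP; apply: eq_integral => t _; rewrite patchE.
  by congr (if _ then _ else _); apply/idP/idP; rewrite inE.
rewrite fubini_tonelli1; first last.
- by move=> z; apply: erestrict_ge0 => w _; rewrite lee_fin chordw_ge0.
- exact: mr.
apply: le_lower_integral => c _; apply/andP; split.
  by apply: integral_ge0 => t _; apply: erestrict_ge0 => w _; rewrite lee_fin chordw_ge0.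
apply: le_trans (chordw_integral M c); rewrite /fubini_F.
rewrite le_eqVlt; apply/orP; left; apply/eqP; apply: eq_integral => t _; rewrite patchE.
by congr (if _ then _ else _); apply/idP/idP; rewrite inE /disk/= addrC.
Qed.

(** Stands in for polar coordinates, which would give 2 pi: the horizontal and vertical weights
    [chordw] add up to exactly this integrand, and each has integral at most 4. *)
Lemma power_integral_disk M :
  (\int[@leb2 R]_(z in @disk R) ((2 * M%:R + 2) * (z.1 ^+ 2 + z.2 ^+ 2) ^+ M)%:E <= 8%:E)%E.
Proof.
have [h1 h2] := chordw_integral_disk M.
have cw : continuous (fun z : R * R => chordw M z.2 z.1).
  apply: (@continuousT_comp _ _ _ (fun z : R * R => (z.2, z.1)) _ _ (@chordw_continuous M)).
  by apply: continuous_pair; [exact: snd_continuous|exact: fst_continuous].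
have mr f : continuous f -> measurable_fun (@disk R) (fun z => (f z : R)%:E).
  by move=> cf; apply/measurable_EFinP/measurable_funTS; exact: continuous_measurable_prod.
rewrite (_ : 8%:E = 4%:E + 4%:E)%E; last by rewrite -EFinD; congr EFin; lra.
apply: le_trans (leeD h1 h2); rewrite -ge0_integralD.
- rewrite le_eqVlt; apply/orP; left; apply/eqP; apply: eq_integral => z _.
  rewrite -EFinD; congr EFin; rewrite /chordw (addrC (z.2 ^+ 2)).
  by case: M {h1 h2 cw mr} => [|M] /=; rewrite ?mul0r ?expr0 ?exprS; ring.
- exact: measurable_disk.
- by move=> z _; rewrite lee_fin chordw_ge0.
- by apply: mr; exact: chordw_continuous.
- by move=> z _; rewrite lee_fin chordw_ge0.
- exact: mr.
Qed.

End WeakDerivative.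

(** * Sobolev regularity of the shear *)

Section Layers.
Variable R : realType.
Implicit Types (z : R * R) (n : nat).

Local Notation sq z := (z.1 ^+ 2 + z.2 ^+ 2).

(** The layer times y without the truncations: a polynomial, hence differentiable on the whole
    plane, with the same values on the disk. *)
Definition lpoly n z : R := z.2 * (sq z ^+ (4 ^ n) * (2 + cheb n z.1)).

Definition dlpoly (b : bool) n z : R :=
  let M := (4 ^ n)%N in let c := 2 + cheb n z.1 in
  if b then sq z ^+ M * c + z.2 * (M%:R * sq z ^+ M.-1 * (2 * z.2) * c)
  else z.2 * (M%:R * sq z ^+ M.-1 * (2 * z.1) * c + sq z ^+ M * dcheb n z.1).

Lemma dcheb_continuous n : continuous (@dcheb R n).
Proof.
elim: n => [|n IH] /=; first exact: continuous_cst.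
apply: continuous_mul => //; apply: continuous_mul; first exact: continuous_cst.
exact: cheb_continuous.
Qed.

Lemma der_cheb n (x : R) : is_derive x 1 (@cheb R n) (dcheb n x).
Proof.
elim: n => [|n IH] /=; first exact: der_id.
apply: (is_derive_eq (derD (derM (der_cst 2 x) (derXn 2 IH)) (der_cst (- 1) x))).
by rewrite /= expr1; ring.
Qed.

Lemma lpoly_continuous n : continuous (lpoly n).
Proof.
apply: continuous_mul; first exact: snd_continuous.
apply: continuous_mul; first by apply: continuous_expn; exact: sqnorm_continuous.
apply: continuous_add; first exact: continuous_cst.
by apply: continuousT_comp; [exact: fst_continuous|exact: cheb_continuous].
Qed.

Lemma dlpoly_continuous b n : continuous (dlpoly b n).
Proof.
have cc : continuous (fun z => 2 + cheb n z.1).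
  apply: continuous_add; first exact: continuous_cst.
  by apply: continuousT_comp; [exact: fst_continuous|exact: cheb_continuous].
have cd : continuous (fun z => dcheb n z.1).
  by apply: continuousT_comp; [exact: fst_continuous|exact: dcheb_continuous].
have cq k : continuous (fun z => sq z ^+ k) by apply: continuous_expn; exact: sqnorm_continuous.
have c1 := @fst_continuous R R; have c2 := @snd_continuous R R.
have ck (r : R) : continuous (fun _ : R * R => r) by exact: continuous_cst.
rewrite /dlpoly; case: b.
  apply: continuous_add; first exact: continuous_mul.
  apply: continuous_mul => //; apply: continuous_mul => //.
  by apply: continuous_mul; apply: continuous_mul.
apply: continuous_mul => //; apply: continuous_add; last exact: continuous_mul.
by apply: continuous_mul => //; apply: continuous_mul; apply: continuous_mul.
Qed.

Lemma pder_lpoly b n : pder b (lpoly n) (dlpoly b n).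
Proof.
move=> x y; case: b; rewrite /lpoly /dlpoly/=.
  have dq : is_derive y 1 (fun y => x ^+ 2 + y ^+ 2) (2 * y).
    apply: (is_derive_eq (derD (der_cst (x ^+ 2) y) (derXn 2 (der_id y)))).
    by rewrite /= expr1 mulr1 add0r.
  apply: (is_derive_eq (derM (der_id y) (derM (derXn (4 ^ n) dq) (der_cst (2 + cheb n x) y)))).
  by rewrite mul1r mulr0 addr0.
have dq : is_derive x 1 (fun x => x ^+ 2 + y ^+ 2) (2 * x).
  apply: (is_derive_eq (derD (derXn 2 (der_id x)) (der_cst (y ^+ 2) x))).
  by rewrite /= expr1 mulr1 addr0.
have dc := derD (der_cst 2 x) (der_cheb n x).
apply: (is_derive_eq (derM (der_cst y x) (derM (derXn (4 ^ n) dq) dc))).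
by rewrite mul0r add0r add0r.
Qed.

(** Write q = |z|^2 and M = 4^n. Differentiating q^M loses a factor q, which |2 x y| <= q or y^2 <=
    q restores; the derivative of the Chebyshev factor is at most M by [dcheb_norm]. *)
Lemma dlpoly_le b n z : @disk R z ->
  `|dlpoly b n z| <= 5 * ((2 * (4 ^ n)%:R + 2) * sq z ^+ (4 ^ n)).
Proof.
case: z => x y; rewrite /disk/= => q1.
have q0 : 0 <= x ^+ 2 + y ^+ 2 by rewrite addr_ge0 ?sqr_ge0.
have x1 : `|x| <= 1 by rewrite ler_norml; nra.
have y1 : `|y| <= 1 by rewrite ler_norml; nra.
have := cheb_norm n x1; rewrite ler_norml => /andP[c1 c2].
have c3 : `|2 + cheb n x| <= 3 by rewrite ler_norml; lra.
have := dcheb_norm n x1; rewrite /dlpoly/= -natrX.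
move: (2 + cheb n x) c3 (dcheb n x) => c c3 d d4.
have : (0 < 4 ^ n)%N by rewrite expn_gt0.
case: (4 ^ n)%N d4 => // M d4 _ /=; rewrite exprS.
have p0 : 0 <= (x ^+ 2 + y ^+ 2) ^+ M by rewrite exprn_ge0.
move: (_ ^+ M) p0 => p p0; set q := x ^+ 2 + y ^+ 2 in q0 q1 *.
have M0 : 0 <= M.+1%:R :> R by [].
have qp : 0 <= q * p by rewrite mulr_ge0.
have Mp : 0 <= M.+1%:R * p by rewrite mulr_ge0.
have Mqp : 0 <= M.+1%:R * p * q by rewrite mulr_ge0.
case: b.
  apply: le_trans (ler_normD _ _) _.
  have h1 : `|q * p * c| <= q * p * 3 by rewrite normrM ger0_norm// ler_wpM2l.
  have h2 : `|y * (M.+1%:R * p * (2 * y) * c)| <= M.+1%:R * p * q * 6.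
    have -> : y * (M.+1%:R * p * (2 * y) * c) = M.+1%:R * p * (2 * y ^+ 2) * c by ring.
    rewrite normrM ger0_norm; last by rewrite mulr_ge0// mulr_ge0// sqr_ge0.
    apply: (@le_trans _ _ (M.+1%:R * p * (2 * q) * 3)); last lra.
    apply: ler_pM => //; first by rewrite mulr_ge0// mulr_ge0// sqr_ge0.
    by rewrite ler_wpM2l// ler_wpM2l// lerDr sqr_ge0.
  lra.
rewrite mulrDr; apply: le_trans (ler_normD _ _) _.
have h1 : `|y * (M.+1%:R * p * (2 * x) * c)| <= M.+1%:R * p * q * 3.
  have -> : y * (M.+1%:R * p * (2 * x) * c) = M.+1%:R * p * (2 * x * y) * c by ring.
  rewrite normrM; apply: ler_pM => //; rewrite normrM ger0_norm// ler_wpM2l//.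
  have := sqr_ge0 (x + y); have := sqr_ge0 (x - y); rewrite sqrrB sqrrD => s1 s2.
  by rewrite ler_norml /q; apply/andP; split; lra.
have h2 : `|y * (q * p * d)| <= M.+1%:R * p * q.
  have -> : y * (q * p * d) = q * p * (y * d) by ring.
  rewrite normrM ger0_norm// -mulrA mulrC (mulrC p) ler_wpM2r// normrM.
  by apply: le_trans d4; rewrite ler_piMl.
lra.
Qed.

(** Each of the M terms of 1 + q + ... + q^(M-1) is at least q^M. The bound is free of M, so at each
    point of the disk the derivative series converges however fast the exponents grow. *)
Lemma power_le (M : nat) (q : R) : 0 <= q < 1 -> M%:R * q ^+ M <= (1 - q)^-1.
Proof.
move=> /andP[q0 q1]; have d0 : 0 < 1 - q by rewrite subr_gt0.
rewrite -[leRHS]mul1r ler_pdivlMr//.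
apply: (@le_trans _ _ ((1 - q) * \sum_(i < M) q ^+ i)).
  rewrite mulrC ler_wpM2l ?(ltW d0)//.
  rewrite mulr_natl -[X in _ *+ X](card_ord M) -sumr_const.
  by apply: ler_sum => i _; apply: ler_wiXn2l => //; [exact: ltW|exact: ltnW].
have -> : (1 - q) * (\sum_(i < M) q ^+ i) = 1 - q ^+ M.
  by rewrite -[RHS]opprB subrX1 -mulNr opprB.
by rewrite gerBl exprn_ge0.
Qed.

End Layers.

(** * Partial sums of the height and passage to the limit *)

Section Sobolev.
Variables (R : realType) (frq : nat -> nat).
Local Notation h := (shear (@modulus R frq)).
Local Notation layer := (@layer R frq).
Local Notation sq z := (z.1 ^+ 2 + z.2 ^+ 2).

Definition height_part n (z : R * R) : R := z.2 + series (fun k => amp R k * lpoly (frq k) z) n.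

Definition dheight_part (b : bool) n (z : R * R) : R :=
  b%:R + series (fun k => amp R k * dlpoly b (frq k) z) n.

Definition layer_bound k (z : R * R) : R :=
  amp R k * 5 * ((2 * (4 ^ frq k)%:R + 2) * sq z ^+ (4 ^ frq k)).

(** The 1 covers the derivative of the leading term [z.2]. *)
Definition dominant (z : R * R) : \bar R := (1 + \sum_(0 <= k <oo) (layer_bound k z)%:E)%E.

Lemma series_at0 (f : nat -> R) : series f 0 = 0.
Proof. by rewrite /series/= big_geq. Qed.

Lemma height_part_continuous n : continuous (height_part n).
Proof.
apply: continuous_add; first exact: snd_continuous.
elim: n => [|n IH]; first by under eq_fun do rewrite series_at0; exact: continuous_cst.
under eq_fun do rewrite seriesSr; apply: continuous_add => //.
by apply: continuous_mul; [exact: continuous_cst|exact: lpoly_continuous].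
Qed.

Lemma dheight_part_continuous b n : continuous (dheight_part b n).
Proof.
apply: continuous_add; first exact: continuous_cst.
elim: n => [|n IH]; first by under eq_fun do rewrite series_at0; exact: continuous_cst.
under eq_fun do rewrite seriesSr; apply: continuous_add => //.
by apply: continuous_mul; [exact: continuous_cst|exact: dlpoly_continuous].
Qed.

Lemma pder_cst (b : bool) (c : R) : pder b (fun=> c) (fun=> 0).
Proof. by move=> x y; case: b; exact: der_cst. Qed.

Lemma pder_snd b : pder b (@snd R R) (fun=> b%:R).
Proof. by move=> x y; case: b => /=; [exact: der_id|exact: der_cst]. Qed.

Lemma pder_fst b : pder b (@fst R R) (fun=> (~~ b)%:R).
Proof. by move=> x y; case: b => /=; [exact: der_cst|exact: der_id]. Qed.

Lemma pder_part b n : pder b (height_part n) (dheight_part b n).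
Proof.
apply: pderD; first exact: pder_snd.
elim: n => [|n IH].
  by have := pder_cst b 0; congr (pder b _ _); apply/funext => z; rewrite series_at0.
have := pderD IH (pderM (pder_cst b (amp R n)) (pder_lpoly b (frq n))).
congr (pder b _ _); apply/funext => z; rewrite seriesSr//.
by rewrite mul0r add0r.
Qed.

Lemma height_part_disk n z : @disk R z ->
  height_part n z = z.2 * (1 + series (fun k => amp R k * layer k z) n).
Proof.
case: z => x y; rewrite /disk/= => q1; rewrite /height_part mulrDr mulr1; congr (_ + _).
rewrite /series/= mulr_sumr; apply: eq_bigr => k _.
rewrite /layer /lpoly/= min_l ?ltW// clamp_id; first by ring.
by rewrite ler_norml; nra.
Qed.

Lemma height_part_cvg z : @disk R z -> (fun n => height_part n z) @ \oo --> (h z).2.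
Proof.
move=> Dz; under eq_fun do rewrite height_part_disk//.
apply: cvgM; first exact: cvg_cst.
apply: cvgD; first exact: cvg_cst.
exact: modulus_cvg.
Qed.

Lemma height_part_le n z : @disk R z -> `|height_part n z| <= 7.
Proof.
move=> Dz; rewrite height_part_disk// normrM.
have y1 : `|z.2| <= 1 by move: Dz; rewrite /disk/= ler_norml; nra.
have := amp_tail (fun k => amp_layer frq k z) (leq0n n).
rewrite series_at0 subr0 /amp expr0 mulr1 -/(amp R) => sn.
apply: le_trans (ler_pM _ _ y1 (ler_normD _ _)) _ => //.
rewrite mul1r normr1; lra.
Qed.

Lemma dpart_le b k z : @disk R z -> `|amp R k * dlpoly b (frq k) z| <= layer_bound k z.
Proof.
move=> Dz; rewrite normrM (ger0_norm (ltW (amp_gt0 R k))) /layer_bound -mulrA.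
by apply: ler_wpM2l; [exact: ltW (amp_gt0 R k)|exact: dlpoly_le].
Qed.

Lemma layer_bound_ge0 k z : 0 <= layer_bound k z.
Proof.
rewrite /layer_bound mulr_ge0 ?mulr_ge0 ?(ltW (amp_gt0 R k))// ?addr_ge0//.
by rewrite exprn_ge0// addr_ge0 ?sqr_ge0.
Qed.

Lemma dheight_part_cvg b z : @disk R z -> cvgn (fun n => dheight_part b n z).
Proof.
move=> Dz; apply: is_cvgD; first exact: is_cvg_cst.
apply: (@amp_cvg _ _ (5 * (2 * (1 - sq z)^-1 + 2))) => k.
have q0 : 0 <= sq z by rewrite addr_ge0 ?sqr_ge0.
have /(power_le (4 ^ frq k)) pk : 0 <= sq z < 1 by rewrite q0.
apply: le_trans (dpart_le b k Dz) _; rewrite /layer_bound -mulrA mulrC ler_wpM2r//.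
  exact: ltW (amp_gt0 R k).
rewrite ler_wpM2l// mulrDl -mulrA lerD// ?ler_wpM2l//.
by rewrite -[leRHS]mulr1 ler_wpM2l// exprn_ile1// ltW.
Qed.

Lemma dheight_part_le b n z : @disk R z -> (`|dheight_part b n z|%:E <= dominant z)%E.
Proof.
move=> Dz; apply: (@le_trans _ _ (1 + \sum_(0 <= k < n) (layer_bound k z)%:E)%E); last first.
  rewrite leeD2l//; apply: nneseries_lim_ge => k _.
  by rewrite lee_fin layer_bound_ge0.
rewrite sumEFin -EFinD lee_fin; apply: le_trans (ler_normD _ _) _; apply: lerD.
  by case: b; rewrite ?normr1 ?normr0.
rewrite /series/=; apply: le_trans (ler_norm_sum _ _ _) _.
by apply: ler_sum => k _; exact: dpart_le.
Qed.

Lemma layer_bound_continuous k : continuous (layer_bound k).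
Proof.
have ck (r : R) : continuous (fun _ : R * R => r) by exact: continuous_cst.
apply: continuous_mul => //; apply: continuous_mul => //.
by apply: continuous_expn; exact: sqnorm_continuous.
Qed.

Lemma layer_bound_integral k :
  (\int[@leb2 R]_(z in @disk R) (layer_bound k z)%:E <= (40 * amp R k)%:E)%E.
Proof.
have a0 : 0 <= amp R k * 5 by rewrite mulr_ge0// ltW// amp_gt0.
have cf : continuous (fun z : R * R => (2 * (4 ^ frq k)%:R + 2) * sq z ^+ (4 ^ frq k) : R).
  apply: continuous_mul; first exact: continuous_cst.
  by apply: continuous_expn; exact: sqnorm_continuous.
rewrite /layer_bound; under eq_integral do rewrite EFinM.
rewrite ge0_integralZl_EFin.
- apply: (@le_trans _ _ ((amp R k * 5)%:E * 8%:E)%E).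
    by apply: lee_wpmul2l; [rewrite lee_fin|exact: power_integral_disk].
  by rewrite -EFinM lee_fin; lra.
- exact: measurable_disk.
- move=> z _; rewrite lee_fin mulr_ge0 ?addr_ge0//.
  by rewrite exprn_ge0// addr_ge0 ?sqr_ge0.
- by apply/measurable_EFinP; apply: measurable_funTS; exact: continuous_measurable_prod.
- exact: a0.
Qed.

(** Series and integral commute for nonnegative terms, and the k-th term has integral at most 40
    a_k, for a total of at most 80. *)
Lemma dominant_integrable : (@leb2 R).-integrable (@disk R) dominant.
Proof.
have mb k : measurable_fun (@disk R) (fun z => (layer_bound k z)%:E).
  apply/measurable_EFinP; apply: measurable_funTS; apply: continuous_measurable_prod.
  exact: layer_bound_continuous.
have i1 : (@leb2 R).-integrable (@disk R) (fun=> 1%:E).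
  by apply: (@continuous_integrable_disk R (fun=> 1)); exact: continuous_cst.
suff i2 : (@leb2 R).-integrable (@disk R) (fun z => \sum_(0 <= k <oo) (layer_bound k z)%:E)%E.
  by apply: (integrableD _ i1 i2); exact: measurable_disk.
apply/integrableP; split.
  refine (@ge0_emeasurable_sum _ _ _ _ (fun k z => (layer_bound k z)%:E) xpredT _ _).
    by move=> k z _ _; rewrite lee_fin layer_bound_ge0.
  by move=> k _; exact: mb.
have -> : (\int[@leb2 R]_(z in @disk R) `|\sum_(0 <= k <oo) (layer_bound k z)%:E| =
   \int[@leb2 R]_(z in @disk R) \sum_(0 <= k <oo) (layer_bound k z)%:E)%E.
  apply: eq_integral => z _; rewrite gee0_abs//; apply: nneseries_ge0 => k _ _.
  by rewrite lee_fin layer_bound_ge0.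
rewrite integral_nneseries.
- apply: (@le_lt_trans _ _ (\sum_(0 <= k <oo) (40 * amp R k)%:E)%E).
    apply: lee_nneseries => [k _ _|k _]; last exact: layer_bound_integral.
    by apply: integral_ge0 => z _; rewrite lee_fin layer_bound_ge0.
  apply: (@le_lt_trans _ _ 80%:E); last exact: ltry.
  apply: lime_le.
    by apply: is_cvg_nneseries => k _ _; rewrite lee_fin mulr_ge0// ltW// amp_gt0.
  apply: nearW => n; rewrite sumEFin lee_fin.
  have hk k : `|40 * amp R k| <= 40 * amp R k.
    by rewrite ger0_norm// mulr_ge0// ltW// amp_gt0.
  have := amp_tail hk (leq0n n); rewrite series_at0 subr0 /series/=.
  have -> : amp R 0 = 1 by rewrite /amp expr0.
  by have := ler_norm (\sum_(0 <= k < n) (40 * amp R k)); lra.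
- exact: measurable_disk.
- exact: mb.
- by move=> k z _; rewrite lee_fin layer_bound_ge0.
Qed.

Lemma shear_W11 : W11C (@disk R) h.
Proof.
have ch : continuous h by apply: shear_continuous; exact: modulus_continuous.
split; split.
- apply: continuous_integrable_disk; apply: continuousT_comp ch _; exact: fst_continuous.
- move=> b; exists (fun=> (~~ b)%:R); split.
    by apply: continuous_integrable_disk; exact: continuous_cst.
  move=> phi tphi; apply: (integration_by_parts_disk _ _ (pder_fst b) tphi).
    exact: fst_continuous.
  exact: continuous_cst.
- apply: continuous_integrable_disk; apply: continuousT_comp ch _; exact: snd_continuous.
- move=> b; exists (fun z => limn (fun n => dheight_part b n z)).
  apply: (@weak_derivative_limit R b height_part (dheight_part b) _ _ dominant 7).
  + exact: height_part_continuous.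
  + exact: dheight_part_continuous.
  + exact: pder_part.
  + exact: height_part_le.
  + exact: dheight_part_le.
  + exact: height_part_cvg.
  + by move=> z Dz; exact: dheight_part_cvg.
  + exact: dominant_integrable.
Qed.

End Sobolev.

Lemma expi_eq_of_dist0 (R : realType) (s t : R) :
  eucl_dist (expi s) (expi t) = 0 -> expi s = expi t.
Proof.
rewrite /eucl_dist /expi/= => /eqP; rewrite sqrtr_eq0 => h0.
have c0 : 0 <= (cos s - cos t) ^+ 2 by exact: sqr_ge0.
have s0 : 0 <= (sin s - sin t) ^+ 2 by exact: sqr_ge0.
have /eqP : (cos s - cos t) ^+ 2 = 0 by lra.
have /eqP : (sin s - sin t) ^+ 2 = 0 by lra.
by rewrite !sqrf_eq0 !subr_eq0 => /eqP -> /eqP ->.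
Qed.

Unset Implicit Arguments.

Theorem theorem1p3 (R : realType) :
  exists (Y : set (R * R)) (h : R * R -> R * R),
    bounded_jordan_domain Y /\
    homeo_onto (@cdisk R) (closure Y) h /\
    W11C (@disk R) h /\
    (\int[@leb2 R]_(st in `[0%R, (2 * pi)%R] `*` `[0%R, (2 * pi)%R])
        (internal_dist (closure Y) (h (expi st.1)) (h (expi st.2)) *
         ((eucl_dist (expi st.1) (expi st.2))^-1)%R%:E) = +oo)%E.
Proof.
have cm := @modulus_continuous R frq.
have m1 := @modulus_ge1 R frq; have ml := @modulus_le R frq; have m7 := @modulus_le7 R frq.
exists (shear (@modulus R frq) @` @disk R), (shear (@modulus R frq)).
split; first exact: shear_jordan_domain m7.
split; first exact: shear_homeo.
split; first exact: shear_W11.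
apply/eqP; rewrite -leye_eq -[leLHS](double_integral_edge_quot R).
apply: le_lower_integral => -[s t] _; rewrite lee_fin edge_quot_ge0/=.
set Y := closure _.
have d2 := le_internal_dist Y (shear (@modulus R frq) (expi s)) (shear (@modulus R frq) (expi t)).
have d1 : `|edge frq s - edge frq t| <=
    eucl_dist (shear (@modulus R frq) (expi s)) (shear (@modulus R frq) (expi t)).
  exact: (le_eucl_dist (shear (@modulus R frq) (expi s)) (shear (@modulus R frq) (expi t))).
have e0 : 0 <= eucl_dist (expi s) (expi t) by exact: sqrtr_ge0.
apply: (@le_trans _ _ ((`|edge frq s - edge frq t|)%:E * (eucl_dist (expi s) (expi t))^-1%:E)%E); last first.
  by apply: lee_wpmul2r; rewrite ?lee_fin ?invr_ge0//; apply: le_trans d2; rewrite lee_fin.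
rewrite -EFinM lee_fin /edge_quot/=.
(* When the two points coincide, also for s = 0 and t = 2 pi, the right side is 0 because the
   inverse of 0 is 0; the left side vanishes too, since [edge] depends only on [expi]. *)
have [/expi_eq_of_dist0 st|ep] := eqVneq (eucl_dist (expi s) (expi t)) 0.
  suff -> : edge frq s = edge frq t by rewrite subrr normr0 !mul0r.
  by rewrite /edge st; congr (_ * _); case: st.
have e1 := eucl_dist_expi s t.
have ep' : 0 < eucl_dist (expi s) (expi t) by rewrite lt0r ep.
by rewrite ler_wpM2l// lef_pV2// ?posrE//; exact: lt_le_trans e1.
Qed.
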